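(* Let $a>0$ be fixed, let $g_0\in\mathcal P([-a,a])$, and let $(b_n)_{n\ge1}$ be a nondecreasing sequence of positive reals. For each $n$, let $X_{1,n},\dots,X_{n,n}$ be i.i.d. with density $m_{g_0,b_n}$, and let $\widehat g_n$ be the NPMLE over $\mathcal P([-a,a])$ based on this sample with noise scale $b_n$. Then, as $n\to\infty$, $$W_1(\widehat g_n,g_0)=\mathcal O_p\left(a\,n^{-3/8}+b_n\,n^{-3/16}\sqrt{\log n}\right).$$ In particular, if $$b_n=o\left(n^{3/16}(\log n)^{-1/2}\right),$$ then $W_1(\widehat g_n,g_0)\to0$ in probability. Equivalently, in terms of the privacy loss budget $\epsilon_n=2a/b_n$, this condition on $b_n$ says that $\epsilon_n$ does not decay as fast as $n^{-3/16}(\log n)^{1/2}$, i.e. $n^{-3/16}(\log n)^{1/2}=o(\epsilon_n)$.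
   Context: $\mathcal P([-a,a])$ is the set of all Borel probability measures on $[-a,a]$. For $b>0$, $f_b(z)=\frac{1}{2b}e^{-|z|/b}$ is the Laplace density; for $g\in\mathcal P([-a,a])$, $m_{g,b}(x)=\int_{[-a,a]}f_b(x-\theta)\,g(\mathrm d\theta)$. The NPMLE $\widehat g_n$ is a maximizer of $g\mapsto\sum_{i=1}^n\log m_{g,b_n}(X_{i,n})$ over $\mathcal P([-a,a])$. $W_1$ is the 1-Wasserstein distance. $Y_n=\mathcal O_p(\rho_n)$ means that $Y_n/\rho_n$ is bounded in probability as $n\to\infty$. *)

(* Defs.v *)
From HB Require Import structures.
From mathcomp Require Export all_boot all_order all_algebra.
From mathcomp Require Export all_classical all_reals all_analysis.
Set Implicit Arguments.
Unset Strict Implicit.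
Unset Printing Implicit Defensive.
Export Order.TTheory GRing.Theory Num.Theory.
Export numFieldNormedType.Exports.
Local Open Scope classical_set_scope.
Local Open Scope ring_scope.

Notation borel_prob R := (probability (measurableTypeR R) R).

(* A Borel probability measure on [-a, a] is encoded as a Borel probability
   measure on the line that gives full mass to [-a, a]. *)
Definition prob_on (R : realType) (a : R) : set (borel_prob R) :=
  [set g | g `[- a, a]%classic = 1%E].

Definition laplace_pdf (R : realType) (b z : R) : R :=
  (2 * b)^-1 * expR (- (`|z| / b)).

Definition laplace_mixture (R : realType) (a b : R) (g : borel_prob R)
    (x : R) : R :=
  Rintegral g `[- a, a]%classic (fun theta => laplace_pdf b (x - theta)).

Definition is_npmle (R : realType) (a b : R) (n : nat) (x : 'I_n -> R)
    (g : borel_prob R) : Prop :=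
  prob_on a g /\
  forall h : borel_prob R, prob_on a h ->
    \sum_(i < n) ln (laplace_mixture a b h (x i)) <=
    \sum_(i < n) ln (laplace_mixture a b g (x i)).

Definition is_coupling (R : realType) (mu nu : borel_prob R)
    (p : probability (measurableTypeR R * measurableTypeR R)%type R) : Prop :=
  forall A : set R, measurable A ->
    p (A `*` setT) = mu A /\ p (setT `*` A) = nu A.

Definition wasserstein1 (R : realType) (mu nu : borel_prob R) : \bar R :=
  ereal_inf [set (\int[p]_z (`|z.1 - z.2|)%:E)%E | p in is_coupling mu nu].

Definition has_density (R : realType) (d : measure_display)
    (T : measurableType d) (P : probability T R) (X : {RV P >-> R})
    (f : R -> R) : Prop :=
  forall A : set R, measurable A ->
    distribution P X A = (\int[lebesgue_measure]_(x in A) (f x)%:E)%E.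

(* The product rule over subfamilies is the case where some of the A i are the
   whole line. *)
Definition mutually_independent (R : realType) (d : measure_display)
    (T : measurableType d) (P : probability T R) (n : nat)
    (X : 'I_n -> {RV P >-> R}) : Prop :=
  forall A : 'I_n -> set R, (forall i, measurable (A i)) ->
    P (\bigcap_i (X i @^-1` A i)) = (\prod_(i < n) P (X i @^-1` A i))%E.

(* Nothing guarantees that a selection of maximizers is measurable, so the two
   notions below use the outer measure [mu_ext P] of P, which agrees with P on
   measurable events. The probability space is allowed to change with n. *)
Definition bigOp (R : realType) (d : nat -> measure_display)
    (T : forall n, measurableType (d n)) (P : forall n, probability (T n) R)
    (Y : forall n, T n -> \bar R) (rho : nat -> R) : Prop :=
  forall e : R, 0 < e -> exists M : R, \forall n \near \oo,
    (mu_ext (P n) [set w | M%:E < `|Y n w * ((rho n)^-1)%:E|] <= e%:E)%E.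

Definition cvg0_in_prob (R : realType) (d : nat -> measure_display)
    (T : forall n, measurableType (d n)) (P : forall n, probability (T n) R)
    (Y : forall n, T n -> \bar R) : Prop :=
  forall e : R, 0 < e ->
    mu_ext (P n) [set w | (e%:E < `|Y n w|)%E] @[n --> \oo] --> 0%E.

(* Main.v *)
From HB Require Import structures.
From mathcomp Require Import ring lra measurable_realfun uniform_distribution.
Require Import Defs.
Set Implicit Arguments.
Unset Strict Implicit.
Unset Printing Implicit Defensive.
Local Open Scope classical_set_scope.
Local Open Scope ring_scope.

(** Since [b] is nondecreasing, [a / b n] stays below [a / b 1], so after
    rescaling by [b n] the noise scale is 1 and the supports lie in a fixed
    interval. It then suffices to show that [W_1 (ghat, g0) / b n] is
    [O_p (n^(- 3 / 16))] with a constant that depends on that interval only; the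
    rate claimed is larger as soon as [ln n >= 1].

    Write [E_g (t)] for the integral of [exp (- |t - theta / b|)] against [g], a
    multiple of the mixture density at [b t]. The function [ln E_g] is
    1-Lipschitz, affine outside the support, and its second derivative is bounded
    above, because the kink of the Laplace kernel is concave
    ([log_potential_semiconcave]). Let [phi = ln E_g0 - ln E_ghat], sampled on a
    grid of mesh [h <= 1 / n], let [D] be its squared L2 norm and [S] its
    supremum.

    - The likelihood of [ghat] is at least that of [g0], so the empirical mean
      of [phi] is nonpositive, whereas its true mean, a Kullback-Leibler
      divergence, is at least a constant times [D]. Hence
      [D <= C |nu (phi)| + O (h)], where [nu] is the centred empirical measure
      ([discrete_kullback_leibler], [likelihood_cells]).

    - No chaining is needed to bound [nu (phi)]: by Sobolev duality at the scale
      [1 / tau] (in cells), realised here by a one-sided exponential filter,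
      [nu (phi)^2] is at most the filtered energy of [nu] times
      [tau * |phi|^2 + |phi'|^2 / tau + S^2], and the energy has mean [1 / n]
      whatever the mesh ([ar_energy_duality], [ar_energy_mean]). One application
      of Markov's inequality controls all competitors [ghat] simultaneously.

    - Semiconcavity gives [|phi'|_2^2 <= C S] (integrate by parts), and the
      Lipschitz property gives [S^3 <= C D]. At the scale [n^(- 1 / 4)] the
      inequalities close up to [D = O (n^(- 3 / 4))] ([rate_arith]).

    - Finally [1 - d^2/dt^2] maps [E_g] to [2 g]. Its discrete analogue at mesh
      [e] recovers the distribution function of [g] up to one cell, at the price
      of a factor [1 / e]; with the quantile coupling this yields
      [W_1 / b <= C (e + D^(1/2) / e)] ([wasserstein_grid],
      [wasserstein_potential]), and [e = n^(- 3 / 16)] is the optimal choice. *)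

(** * Elementary inequalities and finite sums *)

Section Elementary.
Variable R : realType.
Implicit Types (x y v s : R).

(** Strong convexity of [expR] on a bounded range: this is what makes a
    Kullback-Leibler divergence dominate a squared L2 norm. *)
Lemma expR_ge_quad (B v : R) : 2 <= B -> `|v| <= B ->
  1 + v + v ^+ 2 / (2 * B) <= expR v.
Proof.
move=> B2; rewrite ler_norml => /andP[vl vu].
have B0 : 0 < 2 * B by lra.
have q4 : v ^+ 2 / (2 * B) <= v ^+ 2 / 4.
  by rewrite ler_wpM2l ?sqr_ge0// lef_pV2 ?posrE//; lra.
have half : expR v = expR (v / 2) ^+ 2.
  by rewrite expr2 -expRD; congr expR; field.
have h2 : 1 + v / 2 <= expR (v / 2) by exact: expR_ge1Dx.
case: (leP (- 2) v) => v2.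
  have : (1 + v / 2) ^+ 2 <= expR (v / 2) ^+ 2.
    by rewrite lerXn2r ?nnegrE ?expR_ge0//; lra.
  by rewrite half; nra.
(* here the left-hand side is at most 1 + v / 2, hence negative *)
have : v ^+ 2 / (2 * B) <= - v / 2.
  by rewrite ler_pdivrMr//; nra.
have := expR_gt0 v; lra.
Qed.

Lemma expR_le_lin s : 0 <= s -> s <= 2^-1 -> expR s <= 1 + 2 * s.
Proof.
move=> s0 s2.
have := expR_ge1Dx (- s); rewrite expRN => h.
have e0 := expR_gt0 s.
have : (1 - s) * expR s <= 1.
  by rewrite -ler_pdivlMr// div1r.
nra.
Qed.

Lemma expR_sym_le s : 0 <= s -> s <= 4^-1 -> expR s + expR (- s) <= 2 + 2 * s ^+ 2.
Proof.
move=> s0 s4.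
have h := expR_ge1Dx (- s).
have e0 := expR_gt0 s.
have eN0 := expR_gt0 (- s).
have eN : expR s * expR (- s) = 1 by rewrite -expRD subrr expR0.
have h1 := expR_ge1Dx s.
have eNle : expR (- s) <= 1 by rewrite -expR0 ler_expR; lra.
(* e^s - 1 <= s / (1 - s) <= 4 s / 3 *)
have h2 : expR s * (1 - s) <= 1 by rewrite -[leRHS]eN ler_wpM2l// ltW.
have h3 : expR s - 1 <= 4 / 3 * s.
  have : 0 <= (expR s - 1) * (4^-1 - s) by rewrite mulr_ge0//; lra.
  lra.
have -> : expR s + expR (- s) = 2 + expR (- s) * (expR s - 1) ^+ 2.
  have -> : expR (- s) * (expR s - 1) ^+ 2 =
    expR s * (expR s * expR (- s)) - 2 * (expR s * expR (- s)) + expR (- s) by ring.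
  by rewrite eN; ring.
have : (expR s - 1) ^+ 2 <= (4 / 3 * s) ^+ 2.
  by rewrite lerXn2r ?nnegrE//; lra.
have := sqr_ge0 (expR s - 1); have := sqr_ge0 s; nra.
Qed.

(** The derivative of [ln] is at least 1 on [0, 1]. *)
Lemma ln_expands x y : 0 < x -> x <= 1 -> 0 < y -> y <= 1 ->
  `|x - y| <= `|ln x - ln y|.
Proof.
wlog xy : x y / x <= y.
  move=> H x0 x1 y0 y1; have [xy|/ltW yx] := leP x y; first exact: H.
  by rewrite distrC [leRHS]distrC; exact: H.
move=> x0 x1 y0 y1.
have lxy : ln x <= ln y by rewrite ler_ln.
rewrite distrC [leRHS]distrC !ger0_norm ?subr_ge0//.
have : expR (ln x - ln y) = x / y by rewrite expRD expRN !lnK.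
have := expR_ge1Dx (ln x - ln y) => /[swap] -> h.
have : (1 + (ln x - ln y)) * y <= x by rewrite -ler_pdivlMr.
nra.
Qed.

End Elementary.

Section FiniteSums.
Variable R : realType.
Implicit Types f g p nu : nat -> R.

Lemma sum_cauchy_schwarz N f g :
  (\sum_(k < N) f k * g k) ^+ 2 <=
  (\sum_(k < N) f k ^+ 2) * (\sum_(k < N) g k ^+ 2).
Proof.
rewrite -subr_ge0.
have : 0 <= \sum_(i < N) \sum_(j < N) (f i * g j - f j * g i) ^+ 2.
  by apply: sumr_ge0 => i _; apply: sumr_ge0 => j _; exact: sqr_ge0.
suff -> : \sum_(i < N) \sum_(j < N) (f i * g j - f j * g i) ^+ 2 =
    2 * ((\sum_(k < N) f k ^+ 2) * (\sum_(k < N) g k ^+ 2) -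
         (\sum_(k < N) f k * g k) ^+ 2) by rewrite pmulr_rge0.
rewrite expr2 !big_distrlr/= mulrBr.
rewrite (_ : 2 * (\sum_(i < N) \sum_(j < N) f i ^+ 2 * g j ^+ 2) =
  \sum_(i < N) \sum_(j < N) f i ^+ 2 * g j ^+ 2 +
  \sum_(i < N) \sum_(j < N) f j ^+ 2 * g i ^+ 2); last first.
  by rewrite mulr2n mulrDl !mul1r; congr (_ + _); rewrite exchange_big.
rewrite mulr_sumr -big_split -sumrB/=; apply: eq_bigr => i _.
rewrite mulr_sumr -big_split -sumrB/=; apply: eq_bigr => j _; ring.
Qed.

Lemma sum_sqr_le N f : (\sum_(k < N) `|f k|) ^+ 2 <= N%:R * \sum_(k < N) f k ^+ 2.
Proof.
have := sum_cauchy_schwarz N (fun=> 1) (fun k => `|f k|).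
under eq_bigr do rewrite mul1r.
under [X in _ <= X * _ -> _]eq_bigr do rewrite expr1n.
under [X in _ <= _ * X -> _]eq_bigr do rewrite real_normK ?num_real//.
by rewrite sumr_const card_ord.
Qed.

(** A number [t <= D] satisfies [|t| <= 2 * D - t], and the second differences
    telescope. *)
Lemma semiconcave_total_variation N f (D L : R) : 0 <= D ->
  (forall k, (k < N)%N -> f k.+2 - f k.+1 - (f k.+1 - f k) <= D) ->
  `|f 1%N - f 0%N| <= L -> `|f N.+1 - f N| <= L ->
  \sum_(k < N) `|f k.+2 - f k.+1 - (f k.+1 - f k)| <= 2 * N%:R * D + 2 * L.
Proof.
move=> D0 HD L0 LN.
have tel : \sum_(k < N) (f k.+2 - f k.+1 - (f k.+1 - f k)) =
    f N.+1 - f N - (f 1%N - f 0%N).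
  elim: {HD LN} N => [|N IH]; first by rewrite big_ord0 subrr.
  by rewrite big_ord_recr/= IH; ring.
apply: (@le_trans _ _
    (\sum_(k < N) (2 * D - (f k.+2 - f k.+1 - (f k.+1 - f k))))).
  apply: ler_sum => k _; have := HD k (ltn_ord k).
  by rewrite ler_norml => h; apply/andP; split; lra.
rewrite sumrB tel sumr_const card_ord -mulr_natl.
move: L0 LN; rewrite !ler_norml => /andP[? ?] /andP[? ?]; lra.
Qed.

(** Discrete integration by parts. *)
Lemma sum_sqr_diff_le N f (S L : R) :
  (forall k, (k <= N.+1)%N -> `|f k| <= S) ->
  (forall k, (k < N.+1)%N -> `|f k.+1 - f k| <= L) ->
  \sum_(k < N.+1) (f k.+1 - f k) ^+ 2 <=
  S * (2 * L + \sum_(k < N) `|f k.+2 - f k.+1 - (f k.+1 - f k)|).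
Proof.
move=> HS HL.
have -> : \sum_(k < N.+1) (f k.+1 - f k) ^+ 2 =
    f N.+1 * (f N.+1 - f N) - f 0%N * (f 1%N - f 0%N) -
    \sum_(k < N) f k.+1 * (f k.+2 - f k.+1 - (f k.+1 - f k)).
  elim: {HS HL} N => [|N IH].
    by rewrite big_ord_recr !big_ord0/=; ring.
  by rewrite big_ord_recr/= IH [in RHS]big_ord_recr/=; ring.
have bd x y (Y : R) : `|x| <= S -> `|y| <= Y -> `|x * y| <= S * Y.
  by move=> ? ?; rewrite normrM ler_pM.
apply: le_trans (ler_norm _) _.
rewrite [leRHS]mulrDr [S * \sum_(k < N) _]mulr_sumr; apply: (le_trans (ler_normB _ _)); apply: lerD.
  rewrite [leRHS]mulrCA mulr2n mulrDl mul1r.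
  by apply: (le_trans (ler_normB _ _)); apply: lerD; apply: bd;
    rewrite ?HS ?HL.
apply: (le_trans (ler_norm_sum _ _ _)); apply: ler_sum => k _.
by apply: bd => //; rewrite HS// ltnS ltnW.
Qed.

(** The cube telescopes: [|x^3 - y^3| <= 3/2 |x - y| (x^2 + y^2)], so the cube of
    a Lipschitz sequence oscillates by at most its squared norm. *)
Lemma lipschitz_sup_cube N f (h B : R) : 0 < h ->
  (forall k, (k < N)%N -> `|f k.+1 - f k| <= 2 * h) ->
  (forall k, (k <= N)%N -> `|f k| <= B) ->
  B <= N.+1%:R * h ->
  forall j, (j <= N)%N -> `|f j| ^+ 3 <= 7 * (h * \sum_(k < N.+1) f k ^+ 2).
Proof.
move=> h0 HL HB BN j jN.
set D2 := h * _.
pose c k := `|f k| ^+ 3.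
have step k : (k < N)%N -> `|c k.+1 - c k| <= 3 * h * (f k.+1 ^+ 2 + f k ^+ 2).
  move=> kN; have := HL _ kN => HLk.
  have : `| `|f k.+1| - `|f k| | <= 2 * h by exact: le_trans (ler_dist_dist _ _) _.
  rewrite /c -(real_normK (num_real (f k.+1))) -(real_normK (num_real (f k))).
  move: (normr_ge0 (f k.+1)) (normr_ge0 (f k)).
  move: `|f k.+1| `|f k| => x y x0 y0.
  rewrite (_ : x ^+ 3 - y ^+ 3 = (x - y) * (x ^+ 2 + x * y + y ^+ 2)); last by ring.
  move=> d; rewrite normrM [X in _ * X]ger0_norm; last by nra.
  apply: (@le_trans _ _ (2 * h * (x ^+ 2 + x * y + y ^+ 2))).
    by rewrite ler_wpM2r//; nra.
  have := sqr_ge0 (x - y) => xy2.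
  have : 0 <= h * (x - y) ^+ 2 by rewrite mulr_ge0// ltW.
  nra.
have osc n k : (k <= n)%N -> (n <= N)%N ->
    `|c n - c k| <= 3 * h * \sum_(k <= i < n) (f i.+1 ^+ 2 + f i ^+ 2).
  elim: n => [|n IH]; first by rewrite leqn0 => /eqP -> _; rewrite subrr normr0 big_nil mulr0.
  rewrite leq_eqVlt => /predU1P[->|]; first by rewrite subrr normr0 big_geq// mulr0.
  rewrite ltnS => kn nN; rewrite big_nat_recr//= mulrDr.
  rewrite (_ : c n.+1 - c k = c n - c k + (c n.+1 - c n)); last by ring.
  by apply: (le_trans (ler_normD _ _)); rewrite lerD ?IH ?step// ltnW.
have sub k n : (k <= n)%N -> (n <= N)%N ->
    3 * h * \sum_(k <= i < n) (f i.+1 ^+ 2 + f i ^+ 2) <= 6 * D2.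
  move=> kn nN; rewrite /D2 (_ : 6 * _ = 3 * h * (2 * \sum_(k < N.+1) f k ^+ 2)); last by ring.
  rewrite ler_wpM2l//; first by rewrite mulr_ge0// ltW.
  apply: (@le_trans _ _ (\sum_(0 <= i < N) (f i.+1 ^+ 2 + f i ^+ 2))).
    rewrite [leRHS](big_cat_nat (leq0n k))//=; last exact: leq_trans nN.
    rewrite [X in _ <= _ + X](big_cat_nat kn nN)//=.
    have pos m m' : 0 <= \sum_(m <= i < m') (f i.+1 ^+ 2 + f i ^+ 2).
      by apply: sumr_ge0 => i _; rewrite addr_ge0 ?sqr_ge0.
    have := pos 0%N k; have := pos n N; lra.
  rewrite big_mkord big_split/= mulr2n mulrDl mul1r; apply: lerD.
    by rewrite [leRHS]big_ord_recl/= lerDr sqr_ge0.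
  by rewrite [leRHS]big_ord_recr/= lerDl sqr_ge0.
have all k : (k <= N)%N -> c j <= c k + 6 * D2.
  move=> kN; case: (leqP k j) => kj.
    have := le_trans (osc _ _ kj jN) (sub _ _ kj jN).
    by rewrite ler_norml => /andP[_]; lra.
  have := le_trans (osc _ _ (ltnW kj) kN) (sub _ _ (ltnW kj) kN).
  by rewrite ler_norml => /andP[+ _]; lra.
(* averaging over the base point k replaces c k by a multiple of D2 *)
have avg : N.+1%:R * c j <= \sum_(k < N.+1) c k + N.+1%:R * (6 * D2).
  have cst (x : R) : N.+1%:R * x = \sum_(k < N.+1) x.
    by rewrite sumr_const card_ord mulr_natl.
  rewrite !cst -big_split/=.
  by apply: ler_sum => k _; apply: all; rewrite -ltnS.
have cub : \sum_(k < N.+1) c k <= N.+1%:R * D2.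
  rewrite /D2 mulrA; apply: (@le_trans _ _ (B * \sum_(k < N.+1) f k ^+ 2)).
    rewrite mulr_sumr; apply: ler_sum => k _.
    by rewrite /c exprS real_normK ?num_real// ler_wpM2r ?sqr_ge0// HB// -ltnS.
  by rewrite ler_wpM2r// sumr_ge0// => k _; exact: sqr_ge0.
have N0 : 0 < N.+1%:R :> R by rewrite ltr0n.
rewrite -/(c j); have : N.+1%:R * (c j - 7 * D2) <= 0 by nra.
by rewrite pmulr_rle0//; lra.
Qed.

End FiniteSums.

(** * Exponential filters and the empirical process *)

Section ArFilter.
Variable R : realType.
Implicit Types f nu p : nat -> R.

(** A moving average of [nu] over about [1 / (1 - lam)] past cells. It plays the
    role of the square root of the kernel [exp (- |x - y|)], whose reproducing
    space is a Sobolev space of order one. *)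
Definition ar_filter (lam : R) nu (j : nat) : R :=
  \sum_(k < j.+1) lam ^+ (j - k) * nu k.

Lemma ar_filter0 lam nu : ar_filter lam nu 0 = nu 0%N.
Proof. by rewrite /ar_filter big_ord_recl big_ord0/= expr0 mul1r addr0. Qed.

Lemma ar_filterS lam nu j :
  ar_filter lam nu j.+1 = lam * ar_filter lam nu j + nu j.+1.
Proof.
rewrite /ar_filter big_ord_recr/= subnn expr0 mul1r; congr (_ + _).
rewrite mulr_sumr; apply: eq_bigr => k _.
by rewrite subSn ?exprS ?mulrA// -ltnS.
Qed.

Lemma ar_summation_by_parts lam f nu N :
  \sum_(k < N.+1) f k * nu k =
  \sum_(j < N) ar_filter lam nu j * (f j - lam * f j.+1) + ar_filter lam nu N * f N.
Proof.
elim: N => [|N IH]; first by rewrite big_ord_recr !big_ord0/= ar_filter0 mulrC.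
by rewrite big_ord_recr/= IH [in RHS]big_ord_recr/= ar_filterS; ring.
Qed.

Lemma ar_filter_ge0 lam p j : 0 <= lam -> (forall k, 0 <= p k) -> 0 <= ar_filter lam p j.
Proof.
by move=> l0 p0; apply: sumr_ge0 => k _; rewrite mulr_ge0// exprn_ge0.
Qed.

(** Summation by parts against the constant sequence: filtering spreads the
    total mass without changing it. *)
Lemma ar_filter_mass lam p N :
  (1 - lam) * \sum_(j < N) ar_filter lam p j + ar_filter lam p N =
  \sum_(k < N.+1) p k.
Proof.
have /= := ar_summation_by_parts lam (fun=> 1) p N.
under eq_bigr do rewrite mul1r.
by rewrite !mulr1 -mulr_suml mulrC => <-.
Qed.

Definition ar_energy (tau : R) nu N : R :=
  tau * (\sum_(j < N) ar_filter (1 - tau) nu j ^+ 2) + ar_filter (1 - tau) nu N ^+ 2.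

(** A Sobolev norm of [f] at the scale [1 / tau] against the dual norm of [nu]:
    [f j - (1 - tau) * f j.+1] is [tau * f j] minus a multiple of the increment, and
    Cauchy-Schwarz applies to each part. *)
Lemma ar_energy_duality (tau S : R) f nu N : 0 < tau -> tau <= 1 -> `|f N| <= S ->
  (\sum_(k < N.+1) f k * nu k) ^+ 2 <=
  2 * ar_energy tau nu N *
  (2 * tau * (\sum_(k < N.+1) f k ^+ 2) +
   2 / tau * (\sum_(k < N) (f k.+1 - f k) ^+ 2) + S ^+ 2).
Proof.
move=> t0 t1 fS.
rewrite (ar_summation_by_parts (1 - tau)).
set s := ar_filter _ _.
set Xs := \sum_(j < N) _.
set A := \sum_(k < N.+1) f k ^+ 2.
set B := \sum_(k < N) (f k.+1 - f k) ^+ 2.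
rewrite /ar_energy -/s; set Q := \sum_(j < N) s j ^+ 2.
have Q0 : 0 <= Q by apply: sumr_ge0 => i _; exact: sqr_ge0.
have A0 : 0 <= A by apply: sumr_ge0 => i _; exact: sqr_ge0.
have B0 : 0 <= B by apply: sumr_ge0 => i _; exact: sqr_ge0.
have XQ : Xs ^+ 2 <= Q * (2 * tau ^+ 2 * A + 2 * B).
  apply: (le_trans (sum_cauchy_schwarz N s
    (fun j => f j - (1 - tau) * f j.+1))); rewrite ler_wpM2l//.
  apply: (@le_trans _ _ (\sum_(j < N)
      (2 * tau ^+ 2 * f j ^+ 2 + 2 * (f j.+1 - f j) ^+ 2))).
    apply: ler_sum => j _.
    have -> : f j - (1 - tau) * f j.+1 =
        tau * f j - (1 - tau) * (f j.+1 - f j) by ring.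
    have h : (1 - tau) ^+ 2 * (f j.+1 - f j) ^+ 2 <= (f j.+1 - f j) ^+ 2.
      by rewrite ler_piMl ?sqr_ge0// expr_le1//; lra.
    have := sqr_ge0 (tau * f j + (1 - tau) * (f j.+1 - f j)).
    nra.
  rewrite big_split/= -!mulr_sumr lerD2r ler_wpM2l//.
    by rewrite mulr_ge0// sqr_ge0.
  by rewrite /A big_ord_recr/= lerDl sqr_ge0.
have fN : f N ^+ 2 <= S ^+ 2.
  rewrite -(real_normK (num_real (f N))) lerXn2r ?nnegrE//.
  exact: le_trans fS.
have -> : 2 * tau * A + 2 / tau * B = (2 * tau ^+ 2 * A + 2 * B) / tau.
  by field; exact: lt0r_neq0.
set C := 2 * tau ^+ 2 * A + 2 * B in XQ *.
have C0 : 0 <= C.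
  by apply: addr_ge0; apply: mulr_ge0 => //; apply: mulr_ge0 => //; exact: sqr_ge0.
have CT : tau * (C / tau) = C by field; exact: lt0r_neq0.
have CT0 : 0 <= C / tau by rewrite divr_ge0// ltW.
move: (C / tau) CT CT0 => D CT CT0.
apply: (@le_trans _ _ (2 * Xs ^+ 2 + 2 * (s N * f N) ^+ 2)).
  by have := sqr_ge0 (Xs - s N * f N); nra.
have h1 : (s N * f N) ^+ 2 <= s N ^+ 2 * S ^+ 2.
  by rewrite exprMn ler_wpM2l// sqr_ge0.
have h2 : Xs ^+ 2 <= tau * Q * D by apply: le_trans XQ _; rewrite -CT mulrCA mulrA.
have h3 : 0 <= tau * Q * S ^+ 2 by rewrite mulr_ge0 ?sqr_ge0// mulr_ge0// ltW.
have h4 : 0 <= s N ^+ 2 * D by rewrite mulr_ge0 ?sqr_ge0.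
nra.
Qed.

End ArFilter.

Section BoundedMeasurable.
Context d (T : measurableType d) (R : realType) (P : probability T R).
Implicit Types f g : T -> R.

(** This class is closed under sums and products and integrable for every
    probability measure, so second moments expand without separate integrability
    proofs. *)
Definition bounded_measurable f :=
  measurable_fun setT f /\ exists M, forall x, `|f x| <= M.

Lemma bounded_measurable_integrable f :
  bounded_measurable f -> P.-integrable setT (EFin \o f).
Proof.
move=> [mf [M fM]]; apply: measurable_bounded_integrable => //.
  by rewrite [X in (X < _)%E](@probability_setT _ _ _ P) ltry.
by exists M; split; [exact: num_real|move=> x Mx y _ /=; exact: le_trans (ltW Mx)].
Qed.

Lemma bm_cst (c : R) : bounded_measurable (fun=> c).
Proof. by split; [exact: measurable_cst|exists `|c|]. Qed.

Lemma bm_indic (A : set T) : measurable A -> bounded_measurable (\1_A : T -> R).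
Proof.
move=> mA; split; first exact: measurable_realfun.measurable_indic.
by exists 1 => x; rewrite indicE; case: (_ \in _); rewrite ?normr1 ?normr0.
Qed.

Lemma bmD f g : bounded_measurable f -> bounded_measurable g ->
  bounded_measurable (fun x => f x + g x).
Proof.
move=> [mf [M fM]] [mg [N gN]]; split; first exact: measurable_realfun.measurable_funD.
by exists (M + N) => x; rewrite (le_trans (ler_normD _ _))// lerD.
Qed.

Lemma bmM f g : bounded_measurable f -> bounded_measurable g ->
  bounded_measurable (fun x => f x * g x).
Proof.
move=> [mf [M fM]] [mg [N gN]]; split; first exact: measurable_realfun.measurable_funM.
by exists (M * N) => x; rewrite normrM ler_pM.
Qed.

Lemma bmB f g : bounded_measurable f -> bounded_measurable g ->
  bounded_measurable (fun x => f x - g x).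
Proof.
move=> [mf [M fM]] [mg [N gN]]; split; first exact: measurable_realfun.measurable_funB.
by exists (M + N) => x; rewrite (le_trans (ler_normB _ _))// lerD.
Qed.

Lemma bm_sum n (f : 'I_n -> T -> R) : (forall i, bounded_measurable (f i)) ->
  bounded_measurable (fun x => \sum_(i < n) f i x).
Proof.
elim: n f => [|n IH] f hf.
  by under eq_fun do rewrite big_ord0; exact: bm_cst.
by under eq_fun do rewrite big_ord_recl; apply: bmD => //; exact: IH.
Qed.

Lemma Rintegral_prob_cst (c : R) : \int[P]_x c = c.
Proof. by rewrite Rintegral_cst// [X in fine X](@probability_setT _ _ _ P) mulr1. Qed.

Lemma Rintegral_prob_indic (A : set T) : measurable A ->
  \int[P]_x (\1_A x) = fine (P A).
Proof. by move=> mA; rewrite /Rintegral integral_indic// setIT. Qed.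

Lemma Rintegral_bmD f g : bounded_measurable f -> bounded_measurable g ->
  \int[P]_x (f x + g x) = \int[P]_x f x + \int[P]_x g x.
Proof. by move=> hf hg; rewrite RintegralD//; exact: bounded_measurable_integrable. Qed.

Lemma Rintegral_bmZ c f : bounded_measurable f ->
  \int[P]_x (c * f x) = c * \int[P]_x f x.
Proof. by move=> hf; rewrite RintegralZl//; exact: bounded_measurable_integrable. Qed.

Lemma Rintegral_bm_sum n (f : 'I_n -> T -> R) : (forall i, bounded_measurable (f i)) ->
  \int[P]_x (\sum_(i < n) f i x) = \sum_(i < n) \int[P]_x f i x.
Proof.
elim: n f => [|n IH] f hf.
  under eq_Rintegral do rewrite big_ord0.
  by rewrite Rintegral_prob_cst big_ord0.
under eq_Rintegral do rewrite big_ord_recl.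
rewrite Rintegral_bmD//; last by apply: bm_sum.
by rewrite IH// big_ord_recl.
Qed.

Lemma le_Rintegral_bm f g : bounded_measurable f -> bounded_measurable g ->
  (forall x, f x <= g x) -> \int[P]_x f x <= \int[P]_x g x.
Proof.
by move=> hf hg fg; apply: le_Rintegral => //; exact: bounded_measurable_integrable.
Qed.

Lemma bounded_markov f (c M : R) : bounded_measurable f -> (forall x, 0 <= f x) ->
  \int[P]_x f x <= c -> 0 < M -> (P [set x | (M < f x)%R] <= (c / M)%:E)%E.
Proof.
move=> hf f0 fc M0.
have mA : measurable [set x | M < f x].
  rewrite -[X in measurable X]setTI.
  have -> : [set x | M < f x] = f @^-1` `]M, +oo[.
    by apply/seteqP; split => x /=; rewrite in_itv/= andbT.
  by apply: hf.1.
rewrite -(@fineK _ (P _)) ?fin_num_measure// lee_fin ler_pdivlMr// mulrC.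
rewrite -Rintegral_prob_indic// -Rintegral_bmZ; last exact: bm_indic.
apply: le_trans fc; apply: le_Rintegral_bm => //.
  by apply: bmM; [exact: bm_cst|exact: bm_indic].
move=> x; rewrite indicE; case: (boolP (x \in _)); last by rewrite mulr0.
by rewrite inE/= mulr1 => /ltW.
Qed.

(** Empirical process over a finite partition: for a weighted sum of centred
    cell frequencies only the diagonal of the double sum survives. *)
Lemma empirical_second_moment n N (A : 'I_n -> 'I_N -> set T) (p w : 'I_N -> R) :
  (forall i k, measurable (A i k)) ->
  (forall i k, fine (P (A i k)) = p k) ->
  (forall i k l, k != l -> A i k `&` A i l = set0) ->
  (forall i j k l, i != j -> fine (P (A i k `&` A j l)) = p k * p l) ->
  \int[P]_x ((\sum_(k < N) w k * (\sum_(i < n) \1_(A i k) x - n%:R * p k)) ^+ 2)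
    <= n%:R * \sum_(k < N) w k ^+ 2 * p k.
Proof.
move=> mA pA dA iA.
pose mu := \sum_(k < N) w k * p k.
pose Y i x : R := \sum_(k < N) w k * \1_(A i k) x.
have bY i : bounded_measurable (Y i).
  by apply: bm_sum => k; apply: bmM; [exact: bm_cst|exact: bm_indic].
have bYY i j : bounded_measurable (fun x => Y i x * Y j x) by exact: bmM.
have eY i : \int[P]_x Y i x = mu.
  rewrite Rintegral_bm_sum => [|k].
    apply: eq_bigr => k _; rewrite Rintegral_bmZ; last exact: bm_indic.
    by rewrite Rintegral_prob_indic// pA.
  by apply: bmM; [exact: bm_cst|exact: bm_indic].
have eYY i j : \int[P]_x (Y i x * Y j x) =
    \sum_(k < N) \sum_(l < N) w k * w l * fine (P (A i k `&` A j l)).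
  under eq_Rintegral do rewrite big_distrlr/=.
  have b k l : bounded_measurable
      (fun x => (w k * \1_(A i k) x) * (w l * \1_(A j l) x)).
    by apply: bmM; apply: bmM; (exact: bm_cst || exact: bm_indic).
  rewrite Rintegral_bm_sum => [|k]; last exact: bm_sum.
  apply: eq_bigr => k _; rewrite Rintegral_bm_sum//.
  apply: eq_bigr => l _.
  rewrite -Rintegral_prob_indic; last exact: measurableI.
  rewrite -Rintegral_bmZ; last by apply: bm_indic; exact: measurableI.
  by apply: eq_Rintegral => x _; rewrite indicI /=; ring.
have off i j : i != j -> \int[P]_x (Y i x * Y j x) = mu ^+ 2.
  move=> ij; rewrite eYY expr2 /mu big_distrlr/=; apply: eq_bigr => k _.
  by apply: eq_bigr => l _; rewrite iA//; ring.
have diag i : \int[P]_x (Y i x * Y i x) = \sum_(k < N) w k ^+ 2 * p k.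
  rewrite eYY; apply: eq_bigr => k _.
  rewrite (bigD1 k)//= big1 => [|l lk]; first by rewrite addr0 setIid pA expr2.
  by rewrite dA 1?eq_sym// measure0 mulr0.
have -> : \int[P]_x ((\sum_(k < N) w k * (\sum_(i < n) \1_(A i k) x - n%:R * p k)) ^+ 2) =
    \int[P]_x (\sum_(i < n) \sum_(j < n)
      ((Y i x * Y j x) + ((- mu) * Y i x + ((- mu) * Y j x + mu ^+ 2)))).
  apply: eq_Rintegral => x _.
  have -> : \sum_(k < N) w k * (\sum_(i < n) \1_(A i k) x - n%:R * p k) =
      \sum_(i < n) (Y i x - mu).
    rewrite sumrB sumr_const card_ord /Y exchange_big/=.
    rewrite (_ : mu *+ n = n%:R * mu); last by rewrite mulr_natl.
    rewrite /mu mulr_sumr -sumrB.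
    by apply: eq_bigr => k _; rewrite mulrBr mulr_sumr; congr (_ - _); ring.
  rewrite expr2 big_distrlr/=; apply: eq_bigr => i _; apply: eq_bigr => j _; ring.
have b1 i : bounded_measurable (fun x => (- mu) * Y i x).
  by apply: bmM => //; exact: bm_cst.
have b2 i : bounded_measurable (fun x => (- mu) * Y i x + mu ^+ 2).
  by apply: bmD => //; exact: bm_cst.
have b3 i j : bounded_measurable (fun x => - mu * Y i x + (- mu * Y j x + mu ^+ 2)).
  exact: bmD.
have cov i j : \int[P]_x ((Y i x * Y j x) + ((- mu) * Y i x + ((- mu) * Y j x + mu ^+ 2)))
    <= if i == j then \sum_(k < N) w k ^+ 2 * p k else 0.
  rewrite Rintegral_bmD// Rintegral_bmD// Rintegral_bmD//; last exact: bm_cst.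
  rewrite (Rintegral_bmZ _ (bY i)) (Rintegral_bmZ _ (bY j)) Rintegral_prob_cst (eY i) (eY j).
  case: eqVneq => [->|ij]; last by rewrite off//; nra.
  by rewrite diag; have := sqr_ge0 mu; nra.
rewrite Rintegral_bm_sum => [|i]; last by apply: bm_sum => j; exact: bmD.
apply: (@le_trans _ _ (\sum_(i < n) \sum_(k < N) w k ^+ 2 * p k)); last first.
  by rewrite sumr_const card_ord mulr_natl.
apply: ler_sum => i _; rewrite Rintegral_bm_sum => [|j]; last exact: bmD.
apply: (@le_trans _ _ (\sum_(j < n) if i == j then \sum_(k < N) w k ^+ 2 * p k else 0)).
  by apply: ler_sum => j _; exact: cov.
by rewrite -big_mkcond (big_pred1 i) // => j /=; rewrite eq_sym.
Qed.

(** By [empirical_second_moment] the mean energy is a filtered sum of the cell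
    masses with the squared coefficient, and [ar_filter_mass] sums it; no number
    of cells appears. *)
Lemma ar_energy_mean n N (A : 'I_n -> nat -> set T) (p : nat -> R) (tau : R) :
  0 < tau -> tau <= 1 -> (forall k, 0 <= p k) ->
  (forall i k, measurable (A i k)) ->
  (forall i k, fine (P (A i k)) = p k) ->
  (forall i k l, k != l -> A i k `&` A i l = set0) ->
  (forall i j k l, i != j -> fine (P (A i k `&` A j l)) = p k * p l) ->
  \sum_(k < N.+1) p k <= 1 ->
  let nu x k : R := \sum_(i < n) \1_(A i k) x - n%:R * p k in
  bounded_measurable (fun x => ar_energy tau (nu x) N) /\
  \int[P]_x ar_energy tau (nu x) N <= n%:R.
Proof.
move=> t0 t1 p0 mA pA dA iA p1 nu.
have bnu k : bounded_measurable (fun x => nu x k).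
  by apply: bmB; [apply: bm_sum => i; exact: bm_indic|exact: bm_cst].
have bs j : bounded_measurable (fun x => ar_filter (1 - tau) (nu x) j).
  by apply: bm_sum => k; apply: bmM => //; exact: bm_cst.
have bs2 j : bounded_measurable (fun x => ar_filter (1 - tau) (nu x) j ^+ 2).
  by under eq_fun do rewrite expr2; exact: bmM.
have bQ : bounded_measurable
    (fun x => tau * \sum_(j < N) ar_filter (1 - tau) (nu x) j ^+ 2).
  by apply: bmM; [exact: bm_cst|apply: bm_sum].
split; first exact: bmD.
have es j : \int[P]_x (ar_filter (1 - tau) (nu x) j ^+ 2) <=
    n%:R * ar_filter ((1 - tau) ^+ 2) p j.
  have -> : ar_filter ((1 - tau) ^+ 2) p j =
      \sum_(k < j.+1) ((1 - tau) ^+ (j - k)) ^+ 2 * p k.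
    by apply: eq_bigr => k _; rewrite exprAC.
  apply: (@empirical_second_moment n j.+1 (fun i k => A i k) (fun k => p k)
    (fun k => (1 - tau) ^+ (j - k))) => //.
    by move=> i k l kl; exact: dA.
  by move=> i i' k l ii'; exact: iA.
have -> : \int[P]_x ar_energy tau (nu x) N =
    tau * (\sum_(j < N) \int[P]_x (ar_filter (1 - tau) (nu x) j ^+ 2)) +
    \int[P]_x (ar_filter (1 - tau) (nu x) N ^+ 2).
  rewrite -(Rintegral_bm_sum (f := fun (j : 'I_N) x => ar_filter (1 - tau) (nu x) j ^+ 2))//.
  rewrite -Rintegral_bmZ; last exact: bm_sum.
  exact: (Rintegral_bmD bQ (bs2 N)).
apply: (@le_trans _ _ (n%:R * (tau * \sum_(j < N) ar_filter ((1 - tau) ^+ 2) p j +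
    ar_filter ((1 - tau) ^+ 2) p N))).
  rewrite mulrDr; apply: lerD => //.
  rewrite mulrCA ler_wpM2l ?(ltW t0)// mulr_sumr; apply: ler_sum => j _; exact: es.
rewrite -[leRHS]mulr1 ler_wpM2l// (le_trans _ p1)//.
rewrite -(ar_filter_mass ((1 - tau) ^+ 2)) lerD2r ler_wpM2r//.
  apply: sumr_ge0 => j _; apply: ar_filter_ge0; first exact: sqr_ge0.
  exact: p0.
nra.
Qed.

End BoundedMeasurable.

(** * The Laplace potential of a mixing measure *)

(** Arithmetic-geometric mean, then [1 + s^2 <= exp (s^2)]. *)
Lemma log_midpoint (R : realType) (x y z s : R) :
  expR x + expR z <= (2 + 2 * s ^+ 2) * expR y -> x - y - (y - z) <= 2 * s ^+ 2.
Proof.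
move=> H.
have : expR ((x + z) / 2) <= expR (s ^+ 2 + y).
  rewrite expRD.
  have es : (1 + s ^+ 2) * expR y <= expR (s ^+ 2) * expR y.
    by rewrite ler_wpM2r ?expR_ge0// expR_ge1Dx.
  apply: le_trans es.
  suff : 2 * expR ((x + z) / 2) <= expR x + expR z by lra.
  have ex : expR x = expR (x / 2) ^+ 2 by rewrite expr2 -expRD; congr expR; field.
  have ez : expR z = expR (z / 2) ^+ 2 by rewrite expr2 -expRD; congr expR; field.
  rewrite [(x + z) / 2]mulrDl expRD ex ez; have := sqr_ge0 (expR (x / 2) - expR (z / 2)); lra.
by rewrite ler_expR; lra.
Qed.

Section Potential.
Context (R : realType) (a b : R) (b_gt0 : 0 < b).
Implicit Types (g : borel_prob R) (t s theta : R) (f h : R -> R).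

(** Up to the factor [2 * b], the mixture density in the variable [t = x / b]. *)
Definition laplace_potential g t : R :=
  \int[g]_(theta in `[- a, a]%classic) expR (- `|t - theta / b|).

Lemma continuous_kernel t : continuous (fun theta : R => expR (- `|t - theta / b|)).
Proof.
move=> x; apply: continuous_comp; last exact: continuous_expR.
apply: continuousN; apply: continuous_comp; last exact: norm_continuous.
apply: continuousB; first exact: cst_continuous.
by apply: continuousM; [exact: id|exact: cst_continuous].
Qed.

Lemma bm_kernel t :
  bounded_measurable (fun theta : measurableTypeR R => expR (- `|t - theta / b|)).
Proof.
split.
  exact: (measurable_realfun.continuous_measurable_fun (@continuous_kernel t)).
exists 1 => x; rewrite ger0_norm ?expR_ge0//.
Qed.

Lemma bm_integrable_itv g (f : measurableTypeR R -> R) : bounded_measurable f ->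
  g.-integrable `[- a, a]%classic (EFin \o f).
Proof.
move=> hf; apply: (@integrableS _ _ _ _ setT) => //.
exact: bounded_measurable_integrable.
Qed.

Lemma itv_int_cst g c : prob_on a g -> \int[g]_(theta in `[- a, a]%classic) c = c.
Proof.
move=> ga; rewrite Rintegral_cst//.
by rewrite [X in fine X](_ : _ = 1%E) ?mulr1.
Qed.

Lemma itv_int_le g (f h : measurableTypeR R -> R) :
  bounded_measurable f -> bounded_measurable h ->
  (forall x, - a <= x <= a -> f x <= h x) ->
  \int[g]_(theta in `[- a, a]%classic) f theta <=
  \int[g]_(theta in `[- a, a]%classic) h theta.
Proof.
move=> hf hh fh; apply: le_Rintegral => //; exact: bm_integrable_itv.
Qed.

Lemma itv_int_eq g (f h : measurableTypeR R -> R) :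
  (forall x, - a <= x <= a -> f x = h x) ->
  \int[g]_(theta in `[- a, a]%classic) f theta =
  \int[g]_(theta in `[- a, a]%classic) h theta.
Proof. by move=> fh; apply: eq_Rintegral => x; rewrite inE/= in_itv/=; exact: fh. Qed.

Lemma itv_intD g (f h : measurableTypeR R -> R) :
  bounded_measurable f -> bounded_measurable h ->
  \int[g]_(theta in `[- a, a]%classic) (f theta + h theta) =
  \int[g]_(theta in `[- a, a]%classic) f theta +
  \int[g]_(theta in `[- a, a]%classic) h theta.
Proof. by move=> hf hh; rewrite RintegralD//; exact: bm_integrable_itv. Qed.

Lemma itv_intZ g (f : measurableTypeR R -> R) c : bounded_measurable f ->
  \int[g]_(theta in `[- a, a]%classic) (c * f theta) =
  c * \int[g]_(theta in `[- a, a]%classic) f theta.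
Proof. by move=> hf; rewrite RintegralZl//; exact: bm_integrable_itv. Qed.

Lemma bmZ c (f : measurableTypeR R -> R) : bounded_measurable f ->
  bounded_measurable (fun x => c * f x).
Proof. by move=> hf; apply: bmM => //; exact: bm_cst. Qed.

Lemma scaled_itv theta : - a <= theta <= a -> - (a / b) <= theta / b <= a / b.
Proof. by rewrite -mulNr !ler_pM2r ?invr_gt0. Qed.

Lemma laplace_potential_ge g t : prob_on a g ->
  expR (- `|t| - a / b) <= laplace_potential g t.
Proof.
move=> ga; rewrite -[leLHS](itv_int_cst _ ga); apply: itv_int_le.
- exact: bm_cst.
- exact: bm_kernel.
- move=> x /scaled_itv/andP[x1 x2]; rewrite ler_expR -opprD lerN2.
  by rewrite (le_trans (ler_normB _ _))// lerD2l ler_norml x1.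
Qed.

Lemma laplace_potential_le g t : prob_on a g ->
  laplace_potential g t <= expR (- `|t| + a / b).
Proof.
move=> ga; rewrite -[leRHS](itv_int_cst _ ga); apply: itv_int_le.
- exact: bm_kernel.
- exact: bm_cst.
- move=> x /scaled_itv/andP[x1 x2]; rewrite ler_expR.
  have : `|x / b| <= a / b by rewrite ler_norml x1.
  have := ler_normD (t - x / b) (x / b); rewrite subrK; lra.
Qed.

Lemma laplace_potential_le1 g t : prob_on a g -> laplace_potential g t <= 1.
Proof.
move=> ga; rewrite -[leRHS](itv_int_cst _ ga); apply: itv_int_le.
- exact: bm_kernel.
- exact: bm_cst.
- by move=> x _; rewrite -[leRHS]expR0 ler_expR oppr_le0.
Qed.

Lemma laplace_potential_gt0 g t : prob_on a g -> 0 < laplace_potential g t.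
Proof. by move=> ga; apply: lt_le_trans (laplace_potential_ge t ga); exact: expR_gt0. Qed.

(** The exponent is 1-Lipschitz in [t], uniformly in [theta]; hence the potential
    is log-Lipschitz. *)
Lemma laplace_potential_shift g t t' :
  laplace_potential g t' <= expR `|t' - t| * laplace_potential g t.
Proof.
rewrite -itv_intZ; last exact: bm_kernel.
apply: itv_int_le; [exact: bm_kernel|by apply: bmZ; exact: bm_kernel|].
move=> x _; rewrite -expRD ler_expR.
have := ler_normD (t - t') (t' - x / b); rewrite subrKA (distrC t t'); lra.
Qed.

(** The kernel [expR (- |t|)] solves [u - u'' = 2 delta_0]: away from the kink
    the bound is an equality, and the kink is concave. *)
Lemma laplace_potential_midpoint g t s : 0 <= s ->
  laplace_potential g (t + s) + laplace_potential g (t - s) <=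
  (expR s + expR (- s)) * laplace_potential g t.
Proof.
move=> s0; rewrite -itv_intD; [|exact: bm_kernel|exact: bm_kernel].
rewrite -itv_intZ; last exact: bm_kernel.
apply: itv_int_le.
- by apply: bmD; exact: bm_kernel.
- by apply: bmZ; exact: bm_kernel.
move=> x _; rewrite mulrDl -!expRD (_ : t + s - x / b = t - x / b + s); last by ring.
rewrite (_ : t - s - x / b = t - x / b - s); last by ring.
set z := t - x / b; case: (leP 0 z) => z0.
  rewrite (ger0_norm z0) addrC lerD// ler_expR.
    by have := ler_normr (z - s) (z - s); have := ler_norm (z - s); lra.
  by have := ler_norm (z + s); lra.
rewrite (ltr0_norm z0) lerD// ler_expR.
  by have := ler_norm (- (z + s)); rewrite normrN; lra.
by have := ler_norm (- (z - s)); rewrite normrN; lra.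
Qed.

Lemma laplace_potential_right g t s : a / b <= t -> 0 <= s ->
  laplace_potential g (t + s) = expR (- s) * laplace_potential g t.
Proof.
move=> t0 s0; rewrite -itv_intZ; last exact: bm_kernel.
apply: itv_int_eq => x /scaled_itv/andP[x1 x2].
by rewrite -expRD; congr expR; rewrite !ger0_norm; lra.
Qed.

Lemma laplace_potential_left g t s : t <= - (a / b) -> 0 <= s ->
  laplace_potential g (t - s) = expR (- s) * laplace_potential g t.
Proof.
move=> t0 s0; rewrite -itv_intZ; last exact: bm_kernel.
apply: itv_int_eq => x /scaled_itv/andP[x1 x2].
by rewrite -expRD; congr expR; rewrite !ler0_norm; lra.
Qed.

Lemma laplace_mixture_potential g x :
  laplace_mixture a b g x = (2 * b)^-1 * laplace_potential g (x / b).
Proof.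
rewrite -itv_intZ; last exact: bm_kernel.
apply: itv_int_eq => y _; rewrite /laplace_pdf -mulrBl normrM.
by rewrite (@ger0_norm _ b^-1)// invr_ge0 ltW.
Qed.

Definition log_potential g t : R := ln (laplace_potential g t).

Lemma expR_log_potential g t : prob_on a g ->
  expR (log_potential g t) = laplace_potential g t.
Proof. by move=> ga; rewrite lnK// posrE laplace_potential_gt0. Qed.

Lemma log_potential_lip g t t' : prob_on a g ->
  `|log_potential g t' - log_potential g t| <= `|t' - t|.
Proof.
move=> ga.
have E u : expR (log_potential g u) = laplace_potential g u by exact: expR_log_potential.
have H u v : log_potential g u - log_potential g v <= `|u - v|.
  have := laplace_potential_shift g v u; rewrite -!E -expRD ler_expR.
  by rewrite lerBlDr.
by rewrite ler_norml H andbT lerNl opprB distrC H.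
Qed.

(** Passing to logarithms preserves the upper bound on second differences, since
    [ln] is concave. *)
Lemma log_potential_semiconcave g t s : prob_on a g -> 0 <= s -> s <= 4^-1 ->
  log_potential g (t + s) - log_potential g t -
  (log_potential g t - log_potential g (t - s)) <= 2 * s ^+ 2.
Proof.
move=> ga s0 s4.
have E u : expR (log_potential g u) = laplace_potential g u by exact: expR_log_potential.
have := laplace_potential_midpoint g t s0; rewrite -!E => h.
apply: log_midpoint; apply: (le_trans h).
by rewrite ler_wpM2r ?expR_ge0// expR_sym_le.
Qed.

Lemma log_potential_right g t s : prob_on a g -> a / b <= t -> 0 <= s ->
  log_potential g (t + s) = log_potential g t - s.
Proof.
move=> ga t0 s0; rewrite /log_potential laplace_potential_right// lnM ?posrE ?expR_gt0//.
  by rewrite expRK addrC.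
exact: laplace_potential_gt0.
Qed.

Lemma log_potential_left g t s : prob_on a g -> t <= - (a / b) -> 0 <= s ->
  log_potential g (t - s) = log_potential g t - s.
Proof.
move=> ga t0 s0; rewrite /log_potential laplace_potential_left// lnM ?posrE ?expR_gt0//.
  by rewrite expRK addrC.
exact: laplace_potential_gt0.
Qed.

Lemma log_potential_bounds g t : prob_on a g ->
  - `|t| - a / b <= log_potential g t <= - `|t| + a / b.
Proof.
move=> ga; rewrite -![_ <= log_potential _ _]ler_expR -[log_potential _ _ <= _]ler_expR.
by rewrite expR_log_potential// laplace_potential_ge// laplace_potential_le.
Qed.

End Potential.

(** * Total mass of a Laplace mixture *)

Section Mass.
Context (R : realType).
Local Notation mu := (@lebesgue_measure R).

Lemma measurable_translate (c : R) :
  measurable_fun setT ((fun x : R => x - c) : measurableTypeR R -> measurableTypeR R).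
Proof.
apply: (@continuous_measurable_fun R (fun x : R => x - c)).
by move=> x; apply: continuousB; [exact: id|exact: cst_continuous].
Qed.

Lemma lebesgue_measure_translate (c : R) (A : set (measurableTypeR R)) :
  measurable A -> mu A = pushforward mu ((fun x : R => x - c) : _ -> measurableTypeR R) A.
Proof.
move=> mA.
pose phi : {mfun measurableTypeR R >-> measurableTypeR R} :=
  HB.pack ((fun x : R => x - c) : measurableTypeR R -> measurableTypeR R)
   (isMeasurableFun.Build _ _ _ _ _ (measurable_translate c)).
apply: (lebesgue_measure_unique (mu := pushforward mu phi)) => // _ [[x y]] _ <-.
rewrite /pushforward/=.
rewrite [X in _ = mu X](_ : _ = `]x + c, y + c]%classic); last first.
  by apply/seteqP; split => z /=; rewrite !in_itv/= ltrBrDr lerBlDr.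
rewrite !lebesgue_measure_itv/= !lte_fin ltrD2r; case: ifP => // _.
by rewrite -!EFinB; congr EFin; ring.
Qed.

Lemma lebesgue_integral_translate (c : R) (f : R -> \bar R) :
  measurable_fun [set: R] f -> (forall x, 0 <= f x)%E ->
  (\int[mu]_x f (x - c)%R = \int[mu]_x f x)%E.
Proof.
move=> mf f0.
transitivity (\int[pushforward mu ((fun x : R => x - c)%R : _ -> measurableTypeR R)]_x f x)%E.
  by rewrite ge0_integral_pushforward//; exact: measurable_translate.
apply: eq_measure_integral; first exact: measurable_translate.
by move=> mt A mA _; rewrite [RHS](lebesgue_measure_translate c mA).
Qed.

Section MixtureMass.
Variables (a b : R) (b_gt0 : 0 < b).

Lemma laplace_pdf_ge0 z : 0 <= laplace_pdf b z.
Proof. by rewrite mulr_ge0 ?expR_ge0// invr_ge0 mulr_ge0// ltW. Qed.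

Lemma continuous_laplace_pdf : continuous (laplace_pdf b).
Proof.
suff H : continuous (fun z : R => (2 * b)^-1 * expR (- (`|z| / b))) by [].
move=> x; apply: cvgM; first exact: cvg_cst.
apply: continuous_comp; last exact: continuous_expR.
apply: continuousN; apply: continuousM; last exact: cst_continuous.
exact: norm_continuous.
Qed.

Lemma measurable_laplace_pdf : measurable_fun [set: R] (laplace_pdf b).
Proof. exact: (continuous_measurable_fun continuous_laplace_pdf). Qed.

Lemma bm_laplace_pdf x :
  bounded_measurable (fun theta : measurableTypeR R => laplace_pdf b (x - theta)).
Proof.
split.
  apply: (@continuous_measurable_fun R (laplace_pdf b \o (fun theta : R => x - theta))).
  move=> y; apply: continuous_comp; last exact: continuous_laplace_pdf.
  by apply: continuousB; [exact: cst_continuous|exact: id].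
exists (2 * b)^-1 => y; rewrite ger0_norm ?laplace_pdf_ge0// ler_piMr//.
  by rewrite invr_ge0 mulr_ge0// ltW.
by rewrite -[leRHS]expR0 ler_expR oppr_le0 mulr_ge0// invr_ge0 ltW.
Qed.

(** By Tonelli and translation invariance the total mass of a mixture is that
    of its kernel, whatever the mixing measure. *)
Lemma mixture_mass (g : borel_prob R) : prob_on a g ->
  (\int[mu]_x (laplace_mixture a b g x)%:E = \int[mu]_x (laplace_pdf b x)%:E)%E.
Proof.
move=> ga.
pose D : set (measurableTypeR R) := `[- a, a]%classic.
have mD : measurable D by exact: measurable_itv.
pose F (z : measurableTypeR R * measurableTypeR R) := (laplace_pdf b (z.1 - z.2) * \1_D z.2)%:E.
have -> : (\int[mu]_x (laplace_mixture a b g x)%:E = \int[mu]_x \int[g]_y F (x, y))%E.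
  apply: eq_integral => x _; rewrite /laplace_mixture /Rintegral fineK; last first.
    by apply: integrable_fin_num => //; apply: bm_integrable_itv; exact: bm_laplace_pdf.
  rewrite integral_mkcond; apply: eq_integral => y _.
  by rewrite /F/= patchE indicE; case: ifP; rewrite ?mulr1 ?mulr0.
rewrite (fubini_tonelli F); last 2 first.
- apply/measurable_EFinP; apply: measurable_funM.
    apply: (measurableT_comp measurable_laplace_pdf).
    apply: measurable_funB => //.
  by apply: measurableT_comp => //; exact: measurable_indic.
- by move=> z; rewrite lee_fin mulr_ge0// laplace_pdf_ge0.
have E y : (\int[mu]_x F (x, y) = (\1_D y)%:E * \int[mu]_x (laplace_pdf b x)%:E)%E.
  rewrite -(lebesgue_integral_translate y (f := fun x => (laplace_pdf b x)%:E)); last 2 first.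
    by apply/measurable_EFinP; exact: measurable_laplace_pdf.
    by move=> x; rewrite lee_fin laplace_pdf_ge0.
  rewrite -ge0_integralZl//.
  - by apply: eq_integral => x _; rewrite /F/= mulrC EFinM.
  - apply/measurable_EFinP/(measurableT_comp measurable_laplace_pdf).
    exact: measurable_translate.
  - by move=> x _; rewrite lee_fin laplace_pdf_ge0.
under eq_integral do rewrite E.
rewrite ge0_integralZr//.
- by rewrite integral_indic// setIT [X in (X * _)%E](_ : _ = 1%E) ?mul1e.
- exact/measurable_EFinP/measurable_indic.
- by apply: integral_ge0 => x _; rewrite lee_fin laplace_pdf_ge0.
Qed.

End MixtureMass.
End Mass.

(** * Distribution functions *)

Section Cdf.
Context (R : realType).
Implicit Types (g h : borel_prob R) (x y u : R).

Definition mass_le g x : R := fine (g `]-oo, x]%classic).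

Lemma mass_leE g x : g `]-oo, x]%classic = (mass_le g x)%:E.
Proof. by rewrite /mass_le fineK// fin_num_measure. Qed.

Lemma mass_le_ge0 g x : 0 <= mass_le g x.
Proof. by rewrite /mass_le fine_ge0. Qed.

Lemma mass_le_le1 g x : mass_le g x <= 1.
Proof. by rewrite -lee_fin -mass_leE probability_le1. Qed.

Lemma mass_le_mono g x y : x <= y -> mass_le g x <= mass_le g y.
Proof.
move=> xy; rewrite -lee_fin -!mass_leE le_measure// ?inE; [exact: measurable_itv..|].
by apply: subset_itvl; rewrite bnd_simp.
Qed.

Lemma mass_le_lower a g x : prob_on a g -> x < - a -> mass_le g x = 0.
Proof.
move=> ga xa; apply/eqP; rewrite eq_le mass_le_ge0 andbT -lee_fin -mass_leE.
have mD : measurable (`[- a, a]%classic : set (measurableTypeR R)) by exact: measurable_itv.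
have : g (~` `[- a, a]%classic) = 0%E.
  by rewrite probability_setC// [X in (_ - X)%E](_ : _ = 1%E) ?subee.
move=> g0; rewrite -[leRHS]g0; apply: le_measure; rewrite ?inE; [exact: measurable_itv|exact: measurableC|].
by move=> z /=; rewrite !in_itv/= => zx /andP[az _]; move: (lt_le_trans xa az); rewrite ltNge zx.
Qed.

Lemma mass_le_upper a g x : prob_on a g -> a <= x -> mass_le g x = 1.
Proof.
move=> ga xa; apply/eqP; rewrite eq_le mass_le_le1 -lee_fin -mass_leE.
rewrite -[leLHS](_ : g `[- a, a]%classic = 1%E)//.
apply: le_measure; rewrite ?inE; [exact: measurable_itv..|].
by move=> z /=; rewrite !in_itv/= => /andP[_ za]; exact: le_trans xa.
Qed.

(** Right continuity in the form used for quantiles. *)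
Lemma mass_le_right g x u : mass_le g x < u -> exists2 d, 0 < d & mass_le g (x + d) < u.
Proof.
move=> xu.
pose X : {RV g >-> R} := HB.pack (idfun : measurableTypeR R -> R)
  (isMeasurableFun.Build _ _ _ _ (idfun : measurableTypeR R -> R)
     (@measurable_id _ (measurableTypeR R) setT)).
have := @cdf_right_continuous _ _ _ g X x.
have E y : cdf X y = (mass_le g y)%:E by rewrite -mass_leE.
rewrite (_ : cdf X = EFin \o mass_le g); last exact/funext.
move=> /fine_cvg c.
have {}c : mass_le g y @[y --> x^'+] --> mass_le g x by exact: c.
have [y [xy yu]] : exists y, x < y /\ mass_le g y < u.
  near (x^'+) => y; exists y; split; first by near: y; exact: nbhs_right_gt.
  by near: y; exact: (cvgr_lt _ c).
by exists (y - x); rewrite ?subr_gt0// addrC subrK.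
Unshelve. all: by end_near. Qed.

Lemma mass_le_unique (m1 m2 : borel_prob R) :
  (forall x, m1 `]-oo, x]%classic = m2 `]-oo, x]%classic) ->
  forall A, measurable A -> m1 A = m2 A.
Proof.
move=> H.
have S (m : borel_prob R) x y : x <= y ->
    m `]x, y]%classic = (m `]-oo, y]%classic - m `]-oo, x]%classic)%E.
  move=> xy; have -> : `]x, y]%classic = `]-oo, y]%classic `\` `]-oo, x]%classic.
    by rewrite -[RHS]setCK setCD setCitvl setUC -[LHS]setCK setCitv.
  rewrite measureD ?setIidr//; first by apply: subset_itvl; rewrite bnd_simp.
  by rewrite (le_lt_trans (probability_le1 _ _)) ?ltry//; exact: measurable_itv.
move=> A mA; apply: (@measure_unique _ R (measurableTypeR R) (@ocitv R)
  (fun k : nat => `](- k%:R), k%:R]%classic) _ _ _ _ m1 m2) => //.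
- exact: ocitvI.
- by move=> k; exact: is_ocitv.
- by rewrite bigcup_itvT.
- move=> _ [[x y]] _ <- /=; case: (leP x y) => [xy|/ltW yx]; first by rewrite !S// !H.
  by rewrite set_itv_ge ?measure0// bnd_simp -leNgt.
- by move=> k; rewrite (le_lt_trans (probability_le1 _ _)) ?ltry//; exact: measurable_itv.
Qed.

End Cdf.

(** * The quantile coupling *)

Section Quantile.
Context (R : realType) (a : R) (a_gt0 : 0 < a).
Implicit Types (g h : borel_prob R) (x y u : R).

(** The point [a] is added so that the set is nonempty for every real [u], even
    outside the unit interval, and the quantile always lies in the support
    interval. *)
Definition quantile_set g u : set R :=
  [set x | (- a <= x /\ u <= mass_le g x) /\ x <= a \/ x = a].

Definition quantile g u : R := inf (quantile_set g u).

Let qset_a g u : quantile_set g u a. Proof. by right. Qed.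

Let qset_lb g u : lbound (quantile_set g u) (- a).
Proof. by move=> x [[[]]|->]//; have := a_gt0; lra. Qed.

Lemma quantile_ge g u : - a <= quantile g u.
Proof. by apply: lb_le_inf; [exists a; exact: qset_a|exact: qset_lb]. Qed.

Lemma quantile_le g u : quantile g u <= a.
Proof. by apply: ge_inf; [exists (- a); exact: qset_lb|exact: qset_a]. Qed.

Lemma quantile_mono g u v : u <= v -> quantile g u <= quantile g v.
Proof.
move=> uv; apply: lb_le_inf; first by exists a; exact: qset_a.
move=> x Hx; apply: ge_inf; first by exists (- a); exact: qset_lb.
case: Hx => [[[ax vx] xa]|->]; last exact: qset_a.
by left; do 2?split => //; exact: le_trans vx.
Qed.

Lemma quantile_galois g u x : - a <= x -> x < a ->
  (quantile g u <= x) = (u <= mass_le g x).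
Proof.
move=> ax xa; apply/idP/idP; last first.
  move=> ux; apply: ge_inf; first by exists (- a); exact: qset_lb.
  by left; do 2?split => //; exact: ltW.
apply: contraTT; rewrite -!ltNge => xu.
have [d d0 du] := mass_le_right xu.
pose y := Num.min (x + d) a.
have xy : x < y by rewrite lt_min xa andbT ltrDl.
apply: (lt_le_trans xy); apply: lb_le_inf; first by exists a; exact: qset_a.
move=> z [[[az uz] za]|->]; last by rewrite ge_min lexx orbT.
rewrite ge_min; apply/orP; left; rewrite leNgt; apply/negP => zx.
have := mass_le_mono g (ltW zx); lra.
Qed.

Lemma measurable_quantile g :
  measurable_fun setT (quantile g : measurableTypeR R -> measurableTypeR R).
Proof. by apply: nondecreasing_measurable => // x y; exact: quantile_mono. Qed.

Definition unif : borel_prob R := uniform_prob (@ltr01 R).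

Lemma unif_ray c : 0 <= c -> c <= 1 -> unif `]-oo, c]%classic = c%:E.
Proof.
move=> c0 c1; rewrite /unif/= /uniform_prob integral_uniform_pdf.
rewrite (_ : `]-oo, c]%classic `&` `[0, 1]%classic = `[0, c]%classic); last first.
  apply/seteqP; split => z /=; rewrite !in_itv/=; first by move=> [-> /andP[-> _]].
  by move=> /andP[z0 zc]; rewrite zc z0 (le_trans zc).
rewrite (eq_integral (fun=> 1%:E)); last first.
  move=> z; rewrite inE/= in_itv/= => /andP[z0 zc].
  by rewrite /uniform_pdf z0 (le_trans zc)//= subr0 invr1.
rewrite integral_cst//= lebesgue_measure_itv/= lte_fin.
by case: ltgtP c0 => // [_|<-] _; rewrite ?mule0// sube0 mul1e.
Qed.

(** By [quantile_galois] the sublevel sets of the quantile function are rays, of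
    the prescribed uniform mass. *)
Lemma quantile_law g x : prob_on a g ->
  unif [set u | quantile g u <= x] = (mass_le g x)%:E.
Proof.
move=> ga; have [xa|ax] := ltP x (- a).
  rewrite (mass_le_lower ga xa) (_ : [set _ | _] = set0) ?measure0//.
  by apply/seteqP; split => // u /=; have := quantile_ge g u; lra.
have [xa|xa] := ltP x a; last first.
  rewrite (mass_le_upper ga xa) (_ : [set _ | _] = setT) ?probability_setT//.
  by apply/seteqP; split => // u _ /=; have := quantile_le g u; lra.
rewrite -unif_ray ?mass_le_ge0 ?mass_le_le1//; congr (unif _).
by apply/seteqP; split => u /=; rewrite in_itv/= quantile_galois.
Qed.

Lemma quantile_pushforward g A : prob_on a g -> measurable A ->
  unif (quantile g @^-1` A) = g A.
Proof.
move=> ga mA.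
pose q : {RV unif >-> measurableTypeR R} := HB.pack
  (quantile g : measurableTypeR R -> measurableTypeR R)
  (isMeasurableFun.Build _ _ _ _ _ (measurable_quantile g)).
apply: (@mass_le_unique _ (distribution unif q) g) => // x.
by rewrite [RHS]mass_leE -[RHS]quantile_law.
Qed.

(** The middle term is [x] rounded up to the grid: counting the grid points at or
    above [x] locates it up to one cell. *)
Lemma grid_rounding N (x0 e x : R) : 0 < e -> x0 <= x -> x <= x0 + N%:R * e ->
  x <= x0 + N%:R * e - e * \sum_(k < N) (x <= x0 + k%:R * e)%R%:R <= x + e.
Proof.
move=> e0 x0x; elim: N => [|N IH].
  by rewrite big_ord0 mul0r; lra.
rewrite big_ord_recr/= -natr1 => xN.
have [xN'|xN'] := leP x (x0 + N%:R * e).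
  by have := IH xN'; set s := \sum_(k < N) _ => /=; rewrite ?mulr1n; lra.
rewrite big1 => [|k _]; first by rewrite /= ?mulr0n; lra.
apply/eqP; rewrite pnatr_eq0 eqb0 -ltNge (le_lt_trans _ xN')//.
by rewrite lerD2l ler_pM2r// ler_nat ltnW.
Qed.

Lemma grid_separation N (x0 e x y : R) : 0 < e -> x0 <= x -> x <= x0 + N%:R * e ->
  x0 <= y -> y <= x0 + N%:R * e ->
  `|x - y| <= e + e * \sum_(k < N)
     `|(x <= x0 + k%:R * e)%R%:R - (y <= x0 + k%:R * e)%R%:R|.
Proof.
move=> e0 x1 x2 y1 y2.
have := grid_rounding e0 x1 x2; have := grid_rounding e0 y1 y2.
set sx := \sum_(k < N) (x <= _)%R%:R; set sy := \sum_(k < N) (y <= _)%R%:R.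
have : `|sx - sy| <= \sum_(k < N)
    `|(x <= x0 + k%:R * e)%R%:R - (y <= x0 + k%:R * e)%R%:R|.
  by rewrite /sx /sy -sumrB ler_norm_sum.
set s := \sum_(k < N) `| _ |; rewrite ler_norml => /andP[s1 s2] /andP[? ?] /andP[? ?].
have h1 : e * (sx - sy) <= e * s by rewrite ler_wpM2l// ltW.
have h2 : e * (sy - sx) <= e * s by rewrite ler_wpM2l ?(ltW e0)//; lra.
by rewrite ler_norml; lra.
Qed.

(** Two sublevel sets of nondecreasing functions are initial segments of the line,
    hence comparable; so the mass of their symmetric difference is the difference
    of their masses. *)
Lemma quantile_nested g h x :
  (forall u, quantile g u <= x -> quantile h u <= x) \/
  (forall u, quantile h u <= x -> quantile g u <= x).
Proof.
have [?|/existsNP[u /not_implyP[gu hu]]] :=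
  pselect (forall u, quantile g u <= x -> quantile h u <= x); [by left|right].
move=> v hv; apply: le_trans gu; apply: quantile_mono.
rewrite leNgt; apply/negP => uv; apply: hu.
by apply: le_trans hv; apply: quantile_mono; exact: ltW.
Qed.

Let measurable_sublevel g x : measurable ([set u | quantile g u <= x] : set (measurableTypeR R)).
Proof.
rewrite -[X in measurable X]setTI.
have -> : [set u | quantile g u <= x] = quantile g @^-1` `]-oo, x]%classic.
  by apply/seteqP; split => u /=; rewrite in_itv/=.
by apply: measurable_quantile => //; exact: measurable_itv.
Qed.

Let indE g x u : (quantile g u <= x)%R%:R = \1_[set u | quantile g u <= x] u :> R.
Proof. by rewrite indicE; congr ((nat_of_bool _)%:R); apply/idP/idP; rewrite inE. Qed.

Lemma bm_sublevel g x :
  bounded_measurable (fun u : measurableTypeR R => (quantile g u <= x)%R%:R : R).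
Proof. by under eq_fun do rewrite indE; exact: bm_indic. Qed.

Lemma Rintegral_sublevel g x : prob_on a g ->
  \int[unif]_u ((quantile g u <= x)%R%:R : R) = mass_le g x.
Proof.
move=> ga; under eq_Rintegral do rewrite indE.
by rewrite Rintegral_prob_indic// quantile_law.
Qed.

Lemma indicator_distance g h x : prob_on a g -> prob_on a h ->
  \int[unif]_u `|(quantile g u <= x)%R%:R - (quantile h u <= x)%R%:R| =
  `|mass_le g x - mass_le h x|.
Proof.
wlog H : g h / forall u, quantile g u <= x -> quantile h u <= x.
  move=> H ga ha; have [gh|hg] := quantile_nested g h x; first exact: H.
  rewrite [RHS]distrC -H//; apply: eq_Rintegral => u _; exact: distrC.
move=> ga ha; rewrite -(Rintegral_sublevel x ga) -(Rintegral_sublevel x ha).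
rewrite distrC -RintegralB//; try by apply: bounded_measurable_integrable; exact: bm_sublevel.
have le u : (quantile g u <= x)%R%:R <= (quantile h u <= x)%R%:R :> R.
  by rewrite ler_nat; move: (H u); case: (_ <= _) => [->|].
rewrite [RHS]ger0_norm; last by apply: Rintegral_ge0 => u _; rewrite subr_ge0.
by apply: eq_Rintegral => u _; rewrite distrC ger0_norm// subr_ge0.
Qed.

(** By [grid_separation] the distance of two quantiles is, up to one cell, counted
    by the grid points between them; [indicator_distance] gives the expectation
    of each term under the quantile coupling. *)
Lemma wasserstein_grid g h N (x0 e : R) : prob_on a g -> prob_on a h ->
  0 < e -> x0 <= - a -> a <= x0 + N%:R * e ->
  (wasserstein1 g h <= (e + e * \sum_(k < N)
    `|mass_le g (x0 + k%:R * e) - mass_le h (x0 + k%:R * e)|)%:E)%E.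
Proof.
move=> ga ha e0 xa ax.
have mgh : measurable_fun setT
    (fun u : measurableTypeR R => (quantile g u, quantile h u) :
       (measurableTypeR R * measurableTypeR R)%type).
  by apply: measurable_fun_pair; exact: measurable_quantile.
pose q : {RV unif >-> (measurableTypeR R * measurableTypeR R)%type} := HB.pack
  (fun u : measurableTypeR R => (quantile g u, quantile h u) :
     (measurableTypeR R * measurableTypeR R)%type)
  (isMeasurableFun.Build _ _ _ _ _ mgh).
pose p : probability _ R := distribution unif q.
have pc : is_coupling g h p.
  move=> A mA; split.
    rewrite -(quantile_pushforward ga mA) -[LHS]/(unif [set u | A (quantile g u) /\ True]).
    rewrite (_ : [set u | _ /\ True] = quantile g @^-1` A)//.
    by apply/seteqP; split => u /=; tauto.
  rewrite -(quantile_pushforward ha mA) -[LHS]/(unif [set u | True /\ A (quantile h u)]).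
  rewrite (_ : [set u | True /\ _] = quantile h @^-1` A)//.
  by apply/seteqP; split => u /=; tauto.
apply: (@le_trans _ _ (\int[p]_z (`|z.1 - z.2|)%:E)%E).
  by apply: ereal_inf_lbound; exists p.
rewrite ge0_integral_distribution//; last first.
  apply/measurable_EFinP; apply: measurableT_comp => //.
  exact: measurable_funB.
have bq : bounded_measurable (fun u : measurableTypeR R => `|quantile g u - quantile h u|).
  split.
    apply: measurableT_comp => //; apply: measurable_funB; exact: measurable_quantile.
  exists (2 * a) => u; rewrite normr_id ler_norml.
  have := quantile_ge g u; have := quantile_le g u.
  have := quantile_ge h u; have := quantile_le h u; lra.
rewrite [leLHS](_ : _ = (\int[unif]_u `|quantile g u - quantile h u|)%:E); last first.
  by rewrite /Rintegral fineK//; apply: integrable_fin_num => //;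
    exact: bounded_measurable_integrable.
rewrite lee_fin.
have bd k : bounded_measurable (fun u : measurableTypeR R =>
    `|(quantile g u <= x0 + k%:R * e)%R%:R - (quantile h u <= x0 + k%:R * e)%R%:R| : R).
  have [m1 [M1 b1]] := bmB (bm_sublevel g (x0 + k%:R * e)) (bm_sublevel h (x0 + k%:R * e)).
  by split; [exact: measurableT_comp|exists M1 => u; rewrite normr_id].
pose D u := \sum_(k < N)
  `|(quantile g u <= x0 + k%:R * e)%R%:R - (quantile h u <= x0 + k%:R * e)%R%:R| : R.
have bD : bounded_measurable (D : measurableTypeR R -> R) by apply: bm_sum.
apply: (@le_trans _ _ (\int[unif]_u (e + e * D u))).
  apply: le_Rintegral_bm => //.
    by apply: bmD; [exact: bm_cst|exact: bmZ].
  move=> u; apply: grid_separation => //.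
  - exact: le_trans (quantile_ge g u).
  - exact: le_trans (quantile_le g u) _.
  - exact: le_trans (quantile_ge h u).
  - exact: le_trans (quantile_le h u) _.
rewrite Rintegral_bmD; [|exact: bm_cst|exact: bmZ].
rewrite Rintegral_prob_cst Rintegral_bmZ// Rintegral_bm_sum//.
by under eq_bigr do rewrite indicator_distance//.
Qed.

End Quantile.

(** * A discrete Green function *)

Section Tent.
Variable R : realType.
Implicit Types (s t y z e tau : R).

(** Twice the hyperbolic sine. *)
Definition dsinh y : R := expR y - expR (- y).

Lemma dsinh_ge0 y : 0 <= y -> 0 <= dsinh y.
Proof. by move=> y0; rewrite subr_ge0 ler_expR; lra. Qed.

Lemma dsinh_mono y z : y <= z -> dsinh y <= dsinh z.
Proof. by move=> yz; apply: lerB; rewrite ler_expR; lra. Qed.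

Lemma dsinh_ge y : 0 <= y -> y * (2 - y) <= dsinh y.
Proof.
move=> y0; rewrite /dsinh.
have h1 := expR_ge1Dx y; have e0 := expR_gt0 y.
have eN : expR y * expR (- y) = 1 by rewrite -expRD subrr expR0.
move: (expR y) (expR (- y)) h1 e0 eN => p q h1 p0 pq.
have q0 : 0 < q by rewrite -(pmulr_rgt0 _ p0) pq.
have h2 : q * (1 + y) <= 1 by rewrite -[leRHS]pq mulrC ler_wpM2r// ltW.
have h3 : q <= 1 - y + y ^+ 2.
  rewrite -(@ler_pM2r _ (1 + y)); last by lra.
  rewrite (le_trans h2)// (_ : _ * _ = 1 + y ^+ 3); last by ring.
  by rewrite lerDl exprn_ge0.
have : y * (2 - y) = 1 + y - (1 - y + y ^+ 2) by ring.
lra.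
Qed.

Lemma dsinh_le y : 0 <= y -> y < 1 -> (1 - y) * dsinh y <= y * (2 - y).
Proof.
move=> y0 y1; rewrite /dsinh.
have h1 := expR_ge1Dx (- y).
have eN : expR y * expR (- y) = 1 by rewrite -expRD subrr expR0.
have e0 := expR_gt0 y.
move: (expR y) (expR (- y)) h1 e0 eN => p q h1 p0 pq.
have h2 : p * (1 - y) <= 1 by rewrite -[leRHS]pq ler_wpM2l// ltW.
have h3 : (1 - y) * (1 - y) <= (1 - y) * q by rewrite ler_wpM2l//; lra.
have : y * (2 - y) = 1 - (1 - y) * (1 - y) by ring.
lra.
Qed.

(** The difference factors as
    [(p - 1) * (q - 1) * (1 - p^-1 * q^-1)] with [p = expR s] and [q = expR t]. *)
Lemma dsinh_superadditive s t : 0 <= s -> 0 <= t ->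
  dsinh s + dsinh t <= dsinh (s + t).
Proof.
move=> s0 t0; rewrite /dsinh opprD !expRD -subr_ge0.
have p1 : 1 <= expR s by rewrite -[leLHS]expR0 ler_expR.
have q1 : 1 <= expR t by rewrite -[leLHS]expR0 ler_expR.
have p'1 : expR (- s) <= 1 by rewrite -[leRHS]expR0 ler_expR; lra.
have q'1 : expR (- t) <= 1 by rewrite -[leRHS]expR0 ler_expR; lra.
have pp : expR s * expR (- s) = 1 by rewrite -expRD subrr expR0.
have qq : expR t * expR (- t) = 1 by rewrite -expRD subrr expR0.
have p'0 := expR_ge0 (- s); have q'0 := expR_ge0 (- t).
move: (expR s) (expR (- s)) (expR t) (expR (- t)) p1 q1 p'1 q'1 p'0 q'0 pp qq.
move=> p p' q q' p1 q1 p'1 q'1 p'0 q'0 pp qq.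
have E : (p - 1) * p' = 1 - p' by rewrite mulrBl pp mul1r.
have E' : (q - 1) * q' = 1 - q' by rewrite mulrBl qq mul1r.
have -> : p * q - p' * q' - (p - p' + (q - q')) =
  (p - 1) * (q - 1) - (1 - p') * (1 - q') by ring.
rewrite -E -E' subr_ge0 ler_pM//; [by rewrite E; lra|by rewrite E'; lra|..];
  rewrite ler_piMr//; lra.
Qed.

Lemma dsinh_gt0 y : 0 < y -> 0 < dsinh y.
Proof. by move=> y0; rewrite subr_gt0 ltr_expR; lra. Qed.

(** Discrete counterpart of [u - u'']: it annihilates [exp (- |t|)] except
    within one step of the kink. *)
Definition bump e z : R :=
  (expR e + expR (- e)) * expR (- `|z|) - expR (- `|z + e|) - expR (- `|z - e|).

Lemma bump_out e z : 0 <= e -> e <= `|z| -> bump e z = 0.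
Proof.
move=> e0; rewrite ler_normr => /orP[ez|ez]; rewrite /bump mulrDl -!expRD.
  rewrite !ger0_norm; [|lra..].
  have -> : - (z - e) = e - z by ring.
  have -> : - (z + e) = - e - z by ring.
  by ring.
rewrite !ler0_norm; [|lra..].
rewrite !opprK; have -> : z + e = e + z by ring.
have -> : z - e = - e + z by ring.
by ring.
Qed.

Lemma bump_in e z : 0 <= e -> `|z| <= e -> bump e z = dsinh (e - `|z|).
Proof.
move=> e0; rewrite ler_norml => /andP[z1 z2].
rewrite /bump /dsinh mulrDl -!expRD [`|z + e|]ger0_norm; last by lra.
rewrite [`|z - e|]ler0_norm; last by lra.
rewrite opprK; case: (leP 0 z) => z0.
  rewrite (ger0_norm z0) opprB; have -> : - (z + e) = - e - z by ring.
  by ring.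
rewrite (ltr0_norm z0) !opprK.
have -> : - (z + e) = - e - z by ring.
have -> : - (e + z) = - e - z by ring.
have -> : z - e = - e + z by ring.
by ring.
Qed.

Lemma bump_ge0 e z : 0 <= e -> 0 <= bump e z.
Proof.
move=> e0; case: (leP e `|z|) => ez; first by rewrite bump_out.
by rewrite bump_in ?(ltW ez)// dsinh_ge0// subr_ge0 ltW.
Qed.

Definition tent_sum e x1 n tau : R :=
  \sum_(i < n.+1) bump e (x1 + i%:R * e - tau) / dsinh e.

(** Neighbouring bumps overlap in one cell, where they add up to nearly 1 because
    [dsinh] is nearly linear; so a superposition of bumps is a step function up
    to one cell and an error [e]. *)
Lemma tent_sum_shape e x1 n tau : 0 < e -> e < 1 -> x1 <= tau ->
  [/\ tau <= x1 + n%:R * e -> 1 - e <= tent_sum e x1 n tau <= 1,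
      x1 + n%:R * e <= tau -> tent_sum e x1 n tau =
        bump e (x1 + n%:R * e - tau) / dsinh e &
      x1 + n.+1%:R * e <= tau -> tent_sum e x1 n tau = 0].
Proof.
move=> e0 e1 xt; have d0 := dsinh_gt0 e0.
elim: n => [|n [IH1 IH2 IH3]].
  rewrite /tent_sum big_ord_recr big_ord0/= add0r mul0r addr0; split => //.
    move=> tx; have -> : tau = x1 by apply/eqP; rewrite eq_le tx xt.
    rewrite subrr bump_in ?normr0 ?(ltW e0)// subr0 divff ?gt_eqF//; lra.
  by rewrite mul1r => ?; rewrite bump_out ?mul0r ?ler_normr//; lra.
have S : tent_sum e x1 n.+1 tau =
    tent_sum e x1 n tau + bump e (x1 + n.+1%:R * e - tau) / dsinh e.
  by rewrite /tent_sum [in LHS]big_ord_recr.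
have n1 : n.+1%:R = n%:R + 1 :> R by rewrite natr1.
split; last 2 first.
- by move=> h; rewrite S IH3// add0r.
- have n2 : n.+2%:R = n%:R + 2 :> R by rewrite -addn2 natrD.
  rewrite n2 => h; rewrite S IH3; last by rewrite n1; lra.
  by rewrite add0r bump_out ?mul0r ?ler_normr ?(ltW e0)//; rewrite n1; lra.
move=> h; rewrite S; have [tn|tn] := leP tau (x1 + n%:R * e).
  rewrite bump_out ?mul0r ?addr0 ?ler_normr ?(ltW e0)//; first exact: IH1.
  by rewrite n1; lra.
rewrite IH2; last exact: ltW.
have -> : bump e (x1 + n%:R * e - tau) = dsinh (x1 + n.+1%:R * e - tau).
  rewrite bump_in ?(ltW e0)//; last by rewrite ler_norml n1 in h *; lra.
  by rewrite ler0_norm; [congr dsinh; rewrite n1; ring|lra].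
have -> : bump e (x1 + n.+1%:R * e - tau) = dsinh (tau - (x1 + n%:R * e)).
  rewrite bump_in ?(ltW e0)//; last by rewrite ler_norml n1 in h *; lra.
  by rewrite ger0_norm; [congr dsinh; rewrite n1; ring|lra].
rewrite -mulrDl ler_pdivlMr// ler_pdivrMr// mul1r.
set s := x1 + n.+1%:R * e - tau; set t := tau - (x1 + n%:R * e).
have s0 : 0 <= s by rewrite subr_ge0.
have t0 : 0 <= t by rewrite subr_ge0 ltW.
have st : s + t = e by rewrite /s /t n1; ring.
have := dsinh_superadditive s0 t0; rewrite st => ->; rewrite andbT.
have h1 := dsinh_ge s0; have h2 := dsinh_ge t0.
have h3 := dsinh_le (ltW e0) e1.
have : s * (2 - e) <= s * (2 - s) by rewrite ler_wpM2l//; lra.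
have : t * (2 - e) <= t * (2 - t) by rewrite ler_wpM2l//; lra.
have : e * (2 - e) = s * (2 - e) + t * (2 - e) by rewrite -mulrDl st.
lra.
Qed.

Lemma tent_sum_bounds e x1 n tau : 0 < e -> e < 1 -> x1 <= tau ->
  (1 - e) * (tau <= x1 + n%:R * e)%R%:R <= tent_sum e x1 n tau <=
  (tau <= x1 + n.+1%:R * e)%R%:R.
Proof.
move=> e0 e1 xt; have d0 := dsinh_gt0 e0.
have [H1 H2 H3] := tent_sum_shape n e0 e1 xt.
have [t1|t1] := leP tau (x1 + n%:R * e).
  have -> : tau <= x1 + n.+1%:R * e.
    by rewrite (le_trans t1)// lerD2l ler_pM2r// ler_nat.
  by rewrite mulr1; exact: H1.
rewrite mulr0 (H2 (ltW t1)) divr_ge0 ?bump_ge0 ?(ltW e0) ?(ltW d0)//=.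
have [t2|t2] := leP tau (x1 + n.+1%:R * e); last first.
  by rewrite -H2 ?(ltW t1)// H3 ?(ltW t2).
have n1 : n.+1%:R = n%:R + 1 :> R by rewrite natr1.
rewrite ler_pdivrMr// mul1r bump_in ?(ltW e0)//; last first.
  by rewrite ler_norml; rewrite n1 in t2; lra.
by apply: dsinh_mono; rewrite gerBl.
Qed.

End Tent.

(** * Deconvolution: from potentials to the Wasserstein distance *)

(** The sum telescopes to two boundary differences and [c - 2 = O (e^2)] times a
    sum of values. The hypothesis on [u 0] holds to the left of the support,
    where potentials are exponentials; it makes the left boundary term
    negligible. *)
Lemma second_difference_sum_le (R : realType) (u : nat -> R) (e : R) n J :
  0 < e -> e <= 4^-1 -> (n < J)%N -> u 0%N = expR (- e) * u 1%N ->
  `|\sum_(i < n.+1) ((expR e + expR (- e)) * u i.+1 - u i.+2 - u i) / dsinh e| <=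
  4 * \sum_(k < J.+2) `|u k| + (`|u n.+1| + `|u n.+2|) / e.
Proof.
move=> e0 e4 nJ u01; set c := expR e + _.
have -> : \sum_(i < n.+1) (c * u i.+1 - u i.+2 - u i) / dsinh e =
    ((c - 2) * (\sum_(i < n.+1) u i.+1) + (u n.+1 - u n.+2) + (u 1%N - u 0%N)) / dsinh e.
  rewrite -mulr_suml; congr (_ / _).
  elim: n {nJ} => [|n IH]; first by rewrite !big_ord_recr !big_ord0/=; ring.
  by rewrite big_ord_recr/= IH [in RHS]big_ord_recr/=; ring.
set U := \sum_(k < J.+2) _.
have Uu k : (k < J.+2)%N -> `|u k| <= U.
  move=> kJ; rewrite /U (bigD1 (Ordinal kJ))//= lerDl.
  by apply: sumr_ge0.
have U1 : `|\sum_(i < n.+1) u i.+1| <= U.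
  apply: (le_trans (ler_norm_sum _ _ _)).
  rewrite /U [leRHS]big_ord_recl/=.
  rewrite -(big_mkord xpredT (fun i => `|u i.+1|)).
  rewrite [X in _ <= _ + X](_ : _ = \sum_(0 <= i < J.+1) `|u i.+1|); last by rewrite big_mkord.
  rewrite (@big_cat_nat _ _ _ n.+1 0 J.+1)//=; last by rewrite ltnS ltnW.
  have : 0 <= \sum_(n.+1 <= i < J.+1) `|u i.+1| by apply: sumr_ge0.
  by have := normr_ge0 (u 0%N); lra.
have u10 : `|u 1%N - u 0%N| <= 2 * e * U.
  have -> : u 1%N - u 0%N = (1 - expR (- e)) * u 1%N by rewrite u01; ring.
  rewrite normrM ler_pM//; last exact: Uu.
  have h1 := expR_ge1Dx (- e).
  have h2 : expR (- e) <= 1 by rewrite -[leRHS]expR0 ler_expR; lra.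
  by rewrite ger0_norm; lra.
have c2 : `|c - 2| <= 2 * e ^+ 2.
  have h := expR_sym_le (ltW e0) e4.
  have h1 := expR_ge1Dx e; have h2 := expR_ge1Dx (- e).
  by rewrite ger0_norm /c; lra.
have de : e <= dsinh e.
  apply: le_trans (dsinh_ge (ltW e0)); rewrite -[leLHS]mulr1 ler_wpM2l ?(ltW e0)//; lra.
have U0 : 0 <= U by apply: sumr_ge0.
rewrite normrM [X in _ * X]ger0_norm; last by rewrite invr_ge0; lra.
set num := `| _ + _ + _ |.
have hn : num <= 4 * e * U + (`|u n.+1| + `|u n.+2|).
  rewrite /num; apply: (le_trans (ler_normD _ _)).
  have := ler_normD ((c - 2) * \sum_(i < n.+1) u i.+1) (u n.+1 - u n.+2).
  have := ler_normB (u n.+1) (u n.+2).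
  rewrite normrM.
  have : `|c - 2| * `|\sum_(i < n.+1) u i.+1| <= 2 * e ^+ 2 * U by rewrite ler_pM.
  have : 2 * e ^+ 2 * U <= 2 * e * U.
    by rewrite ler_wpM2r// expr2 mulrA ler_piMr ?mulr_ge0 ?(ltW e0)//; lra.
  lra.
apply: (@le_trans _ _ (num / e)).
  by apply: ler_wpM2l; rewrite ?normr_ge0// lef_pV2 ?posrE//; lra.
rewrite ler_pdivrMr// mulrDl mulfVK ?gt_eqF//.
by move: hn; lra.
Qed.

(** The increments of [G] and [H] telescope, so shifting the argument by one cell
    costs a bounded amount in total. *)
Lemma cell_sum_le (R : realType) (G H u : nat -> R) (e : R) J : 0 < e ->
  (forall k, 0 <= u k) -> (forall k, 0 <= G k <= 1) -> (forall k, 0 <= H k <= 1) ->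
  let U := \sum_(k < J.+2) u k in
  (forall j, (j < J)%N -> `|G j - H j| <=
    (G j.+1 - G j) + (H j.+1 - H j) + (4 * U + (u j.+1 + u j.+2) / e + e)) ->
  \sum_(j < J) `|G j - H j| <= 2 + (J%:R * (4 * U + e) + 2 * U / e).
Proof.
move=> e0 u0 G01 H01 U cell.
have tel (q : nat -> R) : (forall k, 0 <= q k <= 1) -> \sum_(j < J) (q j.+1 - q j) <= 1.
  move=> q01; have -> : \sum_(j < J) (q j.+1 - q j) = q J - q 0%N.
    elim: (J) => [|n IH]; first by rewrite big_ord0 subrr.
    by rewrite big_ord_recr/= IH; ring.
  by have /andP[? ?] := q01 J; have /andP[? ?] := q01 0%N; lra.
have s1 : \sum_(j < J) u j.+1 <= U.
  rewrite /U [leRHS]big_ord_recl [X in _ + X]big_ord_recr/=.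
  by have := u0 0%N; have := u0 J.+1; lra.
have s2 : \sum_(j < J) u j.+2 <= U.
  rewrite /U [leRHS]big_ord_recl [X in _ + X]big_ord_recl/=.
  by have := u0 0%N; have := u0 1%N; lra.
apply: (@le_trans _ _ (\sum_(j < J)
    ((G j.+1 - G j) + (H j.+1 - H j) + (4 * U + (u j.+1 + u j.+2) / e + e)))).
  by apply: ler_sum => j _; exact: cell.
rewrite big_split big_split/=; apply: lerD.
  by have := tel G G01; have := tel H H01; lra.
rewrite (eq_bigr (fun j : 'I_J => (4 * U + e) + (u j.+1 + u j.+2) / e)); last first.
  by move=> j _; ring.
rewrite big_split/= sumr_const card_ord -[X in X + _ <= _]mulr_natl lerD2l.
by rewrite -mulr_suml ler_pM2r ?invr_gt0// big_split/=; lra.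
Qed.

Section Deconvolution.
Context (R : realType) (a b : R) (a_gt0 : 0 < a) (b_gt0 : 0 < b).
Implicit Types (g h : borel_prob R) (e x y : R).
Local Notation E := (laplace_potential a b).

Lemma itv_int_sum g n (f : 'I_n -> measurableTypeR R -> R) :
  (forall i, bounded_measurable (f i)) ->
  \int[g]_(theta in `[- a, a]%classic) (\sum_(i < n) f i theta) =
  \sum_(i < n) \int[g]_(theta in `[- a, a]%classic) f i theta.
Proof.
elim: n f => [|n IH] f hf.
  under eq_Rintegral do rewrite big_ord0.
  by rewrite Rintegral_cst ?mul0r ?big_ord0//; exact: measurable_itv.
under eq_Rintegral do rewrite big_ord_recl.
by rewrite itv_intD ?IH ?big_ord_recl//; apply: bm_sum.
Qed.

Lemma bm_ray y : bounded_measurable (fun t : measurableTypeR R => (t <= y)%R%:R : R).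
Proof.
have -> : (fun t : measurableTypeR R => (t <= y)%R%:R : R) = \1_(`]-oo, y]%classic).
  by apply/funext => t; rewrite indicE mem_setE in_itv.
by apply: bm_indic; exact: measurable_itv.
Qed.

Lemma itv_int_mass g y : prob_on a g ->
  \int[g]_(theta in `[- a, a]%classic) ((theta <= y)%R%:R : R) = mass_le g y.
Proof.
move=> ga; rewrite /Rintegral.
have mD : measurable (`[- a, a]%classic : set (measurableTypeR R)) by exact: measurable_itv.
have mA : measurable (`]-oo, y]%classic : set (measurableTypeR R)) by exact: measurable_itv.
rewrite (eq_integral (fun t : measurableTypeR R => (\1_(`]-oo, y]%classic) t)%:E)); last first.
  by move=> t _; rewrite indicE mem_setE in_itv.
rewrite integral_indic//; congr fine; apply/eqP; rewrite eq_le; apply/andP; split.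
  by apply: le_measure; rewrite ?inE//; exact: measurableI.
have g0 : g (~` `[- a, a]%classic) = 0%E.
  by rewrite probability_setC// [X in (_ - X)%E](_ : _ = 1%E) ?subee.
rewrite -[leRHS]adde0 -[X in (_ + X)%E]g0.
apply: (@le_trans _ _ (g ((`]-oo, y] `&` `[- a, a]) `|` ~` `[- a, a])%classic)).
  apply: le_measure; rewrite ?inE//.
    by apply: measurableU; [exact: measurableI|exact: measurableC].
  move=> t /= ty; have [tD|tD] := pselect (t \in `[- a, a]); [by left|by right].
by apply: measureU2; [exact: measurableI|exact: measurableC].
Qed.

Lemma bm_bump e x :
  bounded_measurable (fun theta : measurableTypeR R => bump e (x - theta / b)).
Proof.
have -> : (fun theta : measurableTypeR R => bump e (x - theta / b)) =
    (fun theta => (expR e + expR (- e)) * expR (- `|x - theta / b|) -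
      expR (- `|x + e - theta / b|) - expR (- `|x - e - theta / b|)).
  by apply/funext => t; rewrite /bump ![x - t / b + _]addrAC.
by apply: bmB; [apply: bmB; [apply: bmZ|]|]; exact: bm_kernel.
Qed.

Lemma itv_int_bump g e x :
  \int[g]_(theta in `[- a, a]%classic) bump e (x - theta / b) =
  (expR e + expR (- e)) * E g x - E g (x + e) - E g (x - e).
Proof.
have k := @bm_kernel R b.
transitivity (\int[g]_(theta in `[- a, a]%classic)
    ((expR e + expR (- e)) * expR (- `|x - theta / b|) +
     (-1) * (expR (- `|x + e - theta / b|) + expR (- `|x - e - theta / b|)))).
  by apply: eq_Rintegral => t _; rewrite /bump ![x - t / b + _]addrAC; ring.
rewrite itv_intD; last 2 first.
- by apply: bmZ; exact: k.
- by apply: bmZ; apply: bmD; exact: k.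
rewrite itv_intZ; last exact: k.
rewrite itv_intZ; last by apply: bmD; exact: k.
rewrite itv_intD; [|exact: k|exact: k].
by rewrite mulN1r opprD addrA.
Qed.

Definition tent_mass g e x1 n : R :=
  \int[g]_(theta in `[- a, a]%classic) tent_sum e x1 n (theta / b).

Lemma bm_tent e x1 n :
  bounded_measurable (fun theta : measurableTypeR R => tent_sum e x1 n (theta / b)).
Proof.
apply: bm_sum => i; under eq_fun do rewrite mulrC.
by apply: bmZ; exact: bm_bump.
Qed.

Lemma tent_massE g e x1 n : tent_mass g e x1 n =
  \sum_(i < n.+1) ((expR e + expR (- e)) * E g (x1 + i%:R * e) -
    E g (x1 + i%:R * e + e) - E g (x1 + i%:R * e - e)) / dsinh e.
Proof.
rewrite /tent_mass /tent_sum itv_int_sum => [|i]; last first.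
  by under eq_fun do rewrite mulrC; apply: bmZ; exact: bm_bump.
apply: eq_bigr => i _; rewrite -itv_int_bump [RHS]mulrC -itv_intZ; last exact: bm_bump.
by apply: itv_int_eq => t _; rewrite mulrC.
Qed.

(** Integrate [tent_sum_bounds] against [g]. *)
Lemma tent_mass_bounds g e x1 n : prob_on a g -> 0 < e -> e < 1 -> x1 <= - (a / b) ->
  (1 - e) * mass_le g (b * (x1 + n%:R * e)) <= tent_mass g e x1 n <=
  mass_le g (b * (x1 + n.+1%:R * e)).
Proof.
move=> ga e0 e1 x1a; rewrite -!itv_int_mass//.
have sc (t y : R) : (t <= b * y)%R = (t / b <= y)%R by rewrite ler_pdivrMr// mulrC.
have H t : - a <= t <= a -> x1 <= t / b.
  by move=> /(scaled_itv b_gt0)/andP[h _]; exact: le_trans h.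
apply/andP; split.
  rewrite -itv_intZ; last exact: bm_ray.
  apply: itv_int_le; [by apply: bmZ; exact: bm_ray|exact: bm_tent|].
  by move=> t /H ht; rewrite sc; have /andP[] := tent_sum_bounds n e0 e1 ht.
apply: itv_int_le; [exact: bm_tent|exact: bm_ray|].
by move=> t /H ht; rewrite sc; have /andP[] := tent_sum_bounds n e0 e1 ht.
Qed.

Lemma tent_mass_diff g h e x0 n J : 0 < e -> e <= 4^-1 -> x0 + e <= - (a / b) ->
  (n < J)%N ->
  `|tent_mass g e (x0 + e) n - tent_mass h e (x0 + e) n| <=
  4 * \sum_(k < J.+2) `|E g (x0 + k%:R * e) - E h (x0 + k%:R * e)| +
  (`|E g (x0 + n.+1%:R * e) - E h (x0 + n.+1%:R * e)| +
   `|E g (x0 + n.+2%:R * e) - E h (x0 + n.+2%:R * e)|) / e.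
Proof.
move=> e0 e4 x0a nJ.
have L q : E q (x0 + 0%:R * e) = expR (- e) * E q (x0 + 1%:R * e).
  rewrite -(laplace_potential_left b_gt0 q _ (ltW e0)); last by rewrite mul1r.
  by congr (laplace_potential a b q _); ring.
have := @second_difference_sum_le _
  (fun k => E g (x0 + k%:R * e) - E h (x0 + k%:R * e)) e n J e0 e4 nJ.
rewrite !L -mulrBr => /(_ erefl); congr (`|_| <= _).
rewrite !tent_massE -sumrB; apply: eq_bigr => i _.
have key (F : R -> R) : (expR e + expR (- e)) * F (x0 + e + i%:R * e) -
    F (x0 + e + i%:R * e + e) - F (x0 + e + i%:R * e - e) =
    (expR e + expR (- e)) * F (x0 + i.+1%:R * e) - F (x0 + i.+2%:R * e) - F (x0 + i%:R * e).
  by rewrite -[i.+2%:R]natr1 -[i.+1%:R]natr1;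
    congr (_ * F _ - F _ - F _); ring.
have lin (c A1 A2 B1 B2 C1 C2 d : R) : (c * (A1 - A2) - (B1 - B2) - (C1 - C2)) / d =
  (c * A1 - B1 - C1) / d - (c * A2 - B2 - C2) / d by ring.
by rewrite !key lin.
Qed.

(** The second difference turns potentials into smoothed masses
    ([tent_massE]); summing the errors over the cells, the division by [e] in
    [tent_mass_diff] is absorbed by the mesh of the quantile coupling. *)
Lemma wasserstein_potential g h (x0 e : R) J : prob_on a g -> prob_on a h ->
  0 < e -> e <= 4^-1 -> x0 + e <= - (a / b) -> a / b <= x0 + e + J%:R * e ->
  (wasserstein1 g h <= (b * ((3 + J%:R * e) * e + (4 * (J%:R * e) + 2) *
    \sum_(k < J.+2) `|E g (x0 + k%:R * e) - E h (x0 + k%:R * e)|))%:E)%E.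
Proof.
move=> ga ha e0 e4 x0a ax.
have x1a : b * (x0 + e) <= - a.
  by move: x0a; rewrite -mulNr ler_pdivlMr// mulrC.
have axJ : a <= b * (x0 + e) + J%:R * (b * e).
  have -> : b * (x0 + e) + J%:R * (b * e) = (x0 + e + J%:R * e) * b by ring.
  by rewrite -ler_pdivrMr.
have be0 : 0 < b * e by rewrite mulr_gt0.
apply: (le_trans (wasserstein_grid a_gt0 ga ha be0 x1a axJ)).
rewrite lee_fin.
pose u k := `|E g (x0 + k%:R * e) - E h (x0 + k%:R * e)|.
rewrite -/(\sum_(k < J.+2) u k); set U := \sum_(k < J.+2) u k.
pose y k := b * (x0 + e + k%:R * e).
have Y k : b * (x0 + e) + k%:R * (b * e) = y k by rewrite /y; ring.
have cell j : (j < J)%N -> `|mass_le g (y j) - mass_le h (y j)| <=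
    (mass_le g (y j.+1) - mass_le g (y j)) + (mass_le h (y j.+1) - mass_le h (y j)) +
    (4 * U + (u j.+1 + u j.+2) / e + e).
  move=> jJ.
  have e1 : e < 1 by lra.
  have /andP[g1 g2] := tent_mass_bounds j ga e0 e1 x0a.
  have /andP[h1 h2] := tent_mass_bounds j ha e0 e1 x0a.
  have := tent_mass_diff g h e0 e4 x0a jJ.
  rewrite -/U -/(u j.+1) -/(u j.+2).
  set dlt := 4 * U + _; rewrite ler_norml => /andP[t1 t2].
  rewrite -/(y j) -/(y j.+1) in g1 g2 h1 h2.
  have yy : y j <= y j.+1.
    by rewrite ler_wpM2l ?(ltW b_gt0)// lerD2l ler_wpM2r ?(ltW e0)// ler_nat.
  have mg := mass_le_mono g yy; have mh := mass_le_mono h yy.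
  have G1 : e * mass_le g (y j) <= e by rewrite ler_piMr ?mass_le_le1 ?ltW.
  have H1 : e * mass_le h (y j) <= e by rewrite ler_piMr ?mass_le_le1 ?ltW.
  by rewrite ler_norml; apply/andP; split; lra.
have m01 q k : 0 <= mass_le q (y k) <= 1 by rewrite mass_le_ge0 mass_le_le1.
have := @cell_sum_le _ (fun j => mass_le g (y j)) (fun j => mass_le h (y j)) u e J
  e0 (fun k => normr_ge0 _) (m01 g) (m01 h) cell.
rewrite -/U; under eq_bigr do rewrite -Y.
set S := \sum_(k < J) _; move: (U) (S) => U' S' hS.
have : b * e * S' <= b * e * (2 + (J%:R * (4 * U' + e) + 2 * U' / e)).
  by apply: ler_wpM2l => //; exact: ltW.
have -> : b * e * (2 + (J%:R * (4 * U' + e) + 2 * U' / e)) =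
   b * (2 * e + J%:R * e * (4 * U' + e) + 2 * U').
  by field; rewrite gt_eqF.
lra.
Qed.

End Deconvolution.

(** * The log-ratio of two mixtures *)

Section SubtractionEstimates.
Variable R : realType.
Implicit Types x y z w c : R.

Lemma normB2_le x y z w c : `|x - z| <= c -> `|y - w| <= c ->
  `|x - y - (z - w)| <= 2 * c.
Proof.
move=> h1 h2; rewrite (_ : x - y - (z - w) = (x - z) - (y - w)); last by ring.
by apply: (le_trans (ler_normB _ _)); lra.
Qed.

Lemma normB_range x y z c : z - c <= x <= z + c -> z - c <= y <= z + c ->
  `|x - y| <= 2 * c.
Proof. by move=> /andP[? ?] /andP[? ?]; rewrite ler_norml; lra. Qed.

End SubtractionEstimates.

Section LogRatio.
Context (R : realType) (a b : R) (b_gt0 : 0 < b).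
Context (g0 g1 : borel_prob R) (g0a : prob_on a g0) (g1a : prob_on a g1).

Definition log_ratio t : R := log_potential a b g0 t - log_potential a b g1 t.

Lemma log_ratio_lip t t' : `|log_ratio t' - log_ratio t| <= 2 * `|t' - t|.
Proof. by apply: normB2_le; exact: log_potential_lip. Qed.

Lemma log_ratio_bound t : `|log_ratio t| <= 2 * (a / b).
Proof. by apply: (@normB_range _ _ _ (- `|t|)); exact: log_potential_bounds. Qed.

Lemma log_ratio_right t s : a / b <= t -> 0 <= s -> log_ratio (t + s) = log_ratio t.
Proof.
move=> t0 s0; rewrite /log_ratio !log_potential_right//.
have cancel (x y : R) : x - s - (y - s) = x - y by ring.
exact: cancel.
Qed.

Lemma log_ratio_left t s : t <= - (a / b) -> 0 <= s -> log_ratio (t - s) = log_ratio t.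
Proof.
move=> t0 s0; rewrite /log_ratio !log_potential_left//.
have cancel (x y : R) : x - s - (y - s) = x - y by ring.
exact: cancel.
Qed.

(** Potentials are at most 1, where [ln] expands distances. *)
Lemma laplace_potential_dist t :
  `|laplace_potential a b g1 t - laplace_potential a b g0 t| <= `|log_ratio t|.
Proof.
by rewrite distrC; apply: ln_expands; rewrite ?laplace_potential_gt0 ?laplace_potential_le1.
Qed.

(** The squared increments of [log_ratio] along a grid are summed by parts
    against its second differences, whose total variation semiconcavity
    bounds. *)
Lemma log_ratio_increments y0 (h S : R) N : 0 < h -> h <= 4^-1 ->
  (forall k, (k <= N.+1)%N -> `|log_ratio (y0 + k%:R * h)| <= S) ->
  \sum_(k < N.+1) (log_ratio (y0 + k.+1%:R * h) - log_ratio (y0 + k%:R * h)) ^+ 2 <=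
  S * (h * (8 * (N.+1%:R * h) + 8)).
Proof.
move=> h0 h4 HS.
have S0 : 0 <= S by apply: le_trans (HS 0%N _).
have nS k : y0 + k.+1%:R * h = y0 + k%:R * h + h by rewrite -natr1; ring.
have tv g : prob_on a g -> \sum_(k < N)
    `|log_potential a b g (y0 + k.+2%:R * h) - log_potential a b g (y0 + k.+1%:R * h) -
      (log_potential a b g (y0 + k.+1%:R * h) - log_potential a b g (y0 + k%:R * h))|
    <= 2 * N%:R * (2 * h ^+ 2) + 2 * h.
  move=> ga.
  have step k : `|log_potential a b g (y0 + k.+1%:R * h) - log_potential a b g (y0 + k%:R * h)| <= h.
    apply: (le_trans (log_potential_lip b_gt0 _ _ ga)).
    by rewrite nS addrC addKr ger0_norm// ltW.
  apply: (semiconcave_total_variation (f := fun k => log_potential a b g (y0 + k%:R * h))) => //.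
    by rewrite mulr_ge0 ?sqr_ge0.
  move=> k _ /=.
  have := @log_potential_semiconcave _ a b b_gt0 g (y0 + k.+1%:R * h) h ga (ltW h0) h4.
  by rewrite [y0 + k.+2%:R * h]nS [y0 + k.+1%:R * h - h](_ : _ = y0 + k%:R * h)// nS; ring.
have := @sum_sqr_diff_le _ N (fun k => log_ratio (y0 + k%:R * h)) S (2 * h) HS.
move=> /(_ _)/le_trans; apply.
  move=> k _; apply: (le_trans (log_ratio_lip _ _)).
  by rewrite nS addrC addKr ger0_norm// ltW.
apply: ler_wpM2l => //.
apply: (@le_trans _ _ (2 * (2 * h) + (\sum_(k < N)
    `|log_potential a b g0 (y0 + k.+2%:R * h) - log_potential a b g0 (y0 + k.+1%:R * h) -
      (log_potential a b g0 (y0 + k.+1%:R * h) - log_potential a b g0 (y0 + k%:R * h))| +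
  \sum_(k < N)
    `|log_potential a b g1 (y0 + k.+2%:R * h) - log_potential a b g1 (y0 + k.+1%:R * h) -
      (log_potential a b g1 (y0 + k.+1%:R * h) - log_potential a b g1 (y0 + k%:R * h))|))).
  rewrite lerD2l -big_split; apply: ler_sum => k _ /=.
  have sub (x1 x2 x3 y1 y2 y3 : R) : `|x1 - y1 - (x2 - y2) - (x2 - y2 - (x3 - y3))| <=
      `|x1 - x2 - (x2 - x3)| + `|y1 - y2 - (y2 - y3)|.
    rewrite (_ : x1 - y1 - (x2 - y2) - (x2 - y2 - (x3 - y3)) =
      (x1 - x2 - (x2 - x3)) - (y1 - y2 - (y2 - y3))); last by ring.
    exact: ler_normB.
  exact: sub.
have := tv _ g0a; have := tv _ g1a.
move: (\sum_(k < N) _) (\sum_(k < N) _) => s1 s2 hs2 hs1.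
have : N%:R * h ^+ 2 <= N.+1%:R * h ^+ 2 by rewrite ler_wpM2r ?sqr_ge0// ler_nat.
rewrite (_ : h * _ = 8 * (N.+1%:R * h ^+ 2) + 8 * h); last by ring.
move: hs1 hs2; rewrite (_ : 2 * N%:R * (2 * h ^+ 2) = 4 * (N%:R * h ^+ 2)); last by ring.
move: (N%:R * h ^+ 2) (N.+1%:R * h ^+ 2) => c1 c2; lra.
Qed.

End LogRatio.

(** * Likelihood comparison on cells *)

Section MixtureDensity.
Context (R : realType) (a b : R) (b_gt0 : 0 < b).
Local Notation mu := (@lebesgue_measure R).
Implicit Types g : borel_prob R.

Lemma laplace_mixture_ge0 g x : 0 <= laplace_mixture a b g x.
Proof. by apply: Rintegral_ge0 => t _; exact: laplace_pdf_ge0. Qed.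

Lemma laplace_mixture_exp g x : prob_on a g ->
  laplace_mixture a b g x = (2 * b)^-1 * expR (log_potential a b g (x / b)).
Proof. by move=> ga; rewrite laplace_mixture_potential// expR_log_potential. Qed.

Lemma measurable_laplace_mixture g : prob_on a g ->
  measurable_fun [set: R] (laplace_mixture a b g).
Proof.
move=> ga; have c : continuous (log_potential a b g).
  move=> x; apply/cvgrPdist_le => e e0; near=> t.
  apply: le_trans (log_potential_lip b_gt0 t x ga) _.
  by near: t; apply: cvgr_dist_le => //; exact: cvg_id.
have -> : laplace_mixture a b g = fun x => (2 * b)^-1 * expR (log_potential a b g (x / b)).
  by apply/funext => x; exact: laplace_mixture_exp.
apply: measurable_funM => //; apply: measurableT_comp => //.
apply: (measurableT_comp (continuous_measurable_fun c)).
by apply: measurable_funM.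
Unshelve. all: by end_near. Qed.

Lemma integrable_laplace_mixture g D : prob_on a g -> measurable D ->
  (\int[mu]_x (laplace_mixture a b g x)%:E = 1)%E ->
  mu.-integrable D (EFin \o laplace_mixture a b g).
Proof.
move=> ga mD m1; apply: (@integrableS _ _ _ _ setT) => //.
apply/integrableP; split; first by apply/measurable_EFinP; exact: measurable_laplace_mixture.
under eq_integral => x _ do rewrite /= ger0_norm ?laplace_mixture_ge0//.
by rewrite m1 ltry.
Qed.

End MixtureDensity.

Section Cells.
Context (R : realType) (b A h : R) (N : nat).
Implicit Types (x : R) (k : nat).

(** Consecutive half-lines differ by one cell, so sums over cells telescope. The
    first one is the whole line and the last one empty: the two extreme cells
    absorb the tails. *)
Definition half_line k : set (measurableTypeR R) :=
  if k == 0%N then setT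
  else if (k <= N)%N then `[b * (- A + k%:R * h), +oo[%classic else set0.

Definition cell k : set (measurableTypeR R) := half_line k `\` half_line k.+1.

Lemma measurable_half_line k : measurable (half_line k).
Proof.
by rewrite /half_line; case: eqP => // _; case: ifP => // _; exact: measurable_itv.
Qed.

Lemma measurable_cell k : measurable (cell k).
Proof. by apply: measurableD; exact: measurable_half_line. Qed.

Lemma cell_lower k x : cell k x -> (0 < k)%N -> b * (- A + k%:R * h) <= x.
Proof.
move=> [] + _; rewrite /half_line; case: k => // k /=.
by case: ifP => //= _; rewrite in_itv/= andbT.
Qed.

Lemma cell_upper k x : cell k x -> (k < N)%N -> x < b * (- A + k.+1%:R * h).
Proof.
move=> [_] + kN; rewrite /half_line /= kN /= in_itv/= andbT.
by move/negP; rewrite -ltNge.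
Qed.

Lemma cell_itv k x : 0 < b -> 0 < h -> (k <= N)%N ->
  b * (- A + k%:R * h) <= x < b * (- A + k.+1%:R * h) -> cell k x.
Proof.
move=> b0 h0 kN /andP[kx xk]; split; rewrite /half_line.
  by case: eqP => // _; rewrite kN /= in_itv/= kx.
rewrite /=; case: ifP => [_|_]; last by [].
by move=> /=; rewrite in_itv/= andbT leNgt xk.
Qed.

Hypotheses (b_ge0 : 0 <= b) (h_ge0 : 0 <= h).

Lemma half_line_mono k : half_line k.+1 `<=` half_line k.
Proof.
move=> x; rewrite /half_line/=; case: ifP => // kN; rewrite (ltnW kN).
case: eqP => // _; rewrite /= !in_itv/= !andbT => /(le_trans _); apply.
by rewrite ler_wpM2l// lerD2l ler_wpM2r// ler_nat.
Qed.

Lemma half_line_le k l : (k <= l)%N -> half_line l `<=` half_line k.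
Proof.
elim: l => [|l IH]; first by rewrite leqn0 => /eqP ->.
rewrite leq_eqVlt => /predU1P[->//|]; rewrite ltnS => /IH kl.
exact: subset_trans (@half_line_mono l) kl.
Qed.

Lemma cell_disjoint k l : k != l -> cell k `&` cell l = set0.
Proof.
wlog kl : k l / (k < l)%N.
  move=> H kl; have [h1|h1|h1] := ltngtP k l; first exact: H.
    by rewrite setIC H// eq_sym.
  by rewrite h1 eqxx in kl.
move=> _; apply/seteqP; split => // x [[_ kx] [lx _]].
exact/kx/(half_line_le kl).
Qed.

Lemma cell_indicator_sum x : \sum_(k < N.+1) (\1_(cell k) x : R) = 1.
Proof.
have E k : \1_(cell k) x = \1_(half_line k) x - \1_(half_line k.+1) x :> R.
  rewrite !indicE.
  have [h1|h1] := pselect (half_line k.+1 x).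
    rewrite (mem_set h1) (mem_set (half_line_mono h1)) memNset ?subrr// => -[_]; exact.
  rewrite (memNset h1) subr0; have [h2|h2] := pselect (half_line k x).
    by rewrite (mem_set h2) mem_set.
  by rewrite (memNset h2) memNset// => -[].
under eq_bigr do rewrite E.
have -> : \sum_(k < N.+1) ((\1_(half_line k) x : R) - \1_(half_line k.+1) x) =
    \1_(half_line 0%N) x - \1_(half_line N.+1) x.
  elim: (N.+1) => [|n IH]; first by rewrite big_ord0 subrr.
  by rewrite big_ord_recr/= IH; ring.
by rewrite /half_line/= ltnn indicT indic0 subr0.
Qed.

Lemma cell_mass_sum (f : R -> R) :
  (forall D, measurable D -> (@lebesgue_measure R).-integrable D (EFin \o f)) ->
  \sum_(k < N.+1) \int[lebesgue_measure]_(x in cell k) f x = \int[lebesgue_measure]_x f x.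
Proof.
move=> fi.
have E k : \int[lebesgue_measure]_(x in cell k) f x =
    \int[lebesgue_measure]_(x in half_line k) f x -
    \int[lebesgue_measure]_(x in half_line k.+1) f x.
  have mk := measurable_half_line.
  rewrite -[in RHS](@setDUK _ (half_line k.+1) (half_line k)); last exact: half_line_mono.
  rewrite Rintegral_setU//; [|exact: measurable_cell|..].
  - by rewrite addrC addKr.
  - by apply: fi; apply: measurableU => //; exact: measurable_cell.
  - by rewrite disj_set2E setDIK.
under eq_bigr do rewrite E.
have -> : \sum_(k < N.+1) (\int[lebesgue_measure]_(x in half_line k) f x -
    \int[lebesgue_measure]_(x in half_line k.+1) f x) =
    \int[lebesgue_measure]_(x in half_line 0) f x -
    \int[lebesgue_measure]_(x in half_line N.+1) f x.
  elim: (N.+1) => [|n IH]; first by rewrite big_ord0 subrr.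
  by rewrite big_ord_recr/= IH; ring.
by rewrite /half_line/= ltnn Rintegral_set0 subr0.
Qed.

End Cells.

Section Likelihood.
Context (R : realType) (a b A h : R) (N : nat).
Context (b_gt0 : 0 < b) (h_gt0 : 0 < h) (h4 : h <= 4^-1).
Context (A1 : 1 <= A) (aA : a / b <= A) (NA : N%:R * h = 2 * A).
Context (g0 g1 : borel_prob R) (g0a : prob_on a g0) (g1a : prob_on a g1).
Local Notation mu := (@lebesgue_measure R).
Hypothesis m1 : (\int[mu]_x (laplace_mixture a b g0 x)%:E = 1)%E.
Local Notation phi := (log_ratio a b g0 g1).
Local Notation y k := (- A + k%:R * h).
Local Notation C k := (cell b A h N k).
Local Notation p k := (\int[mu]_(x in C k) laplace_mixture a b g0 x).

(** Between grid points this is the Lipschitz property; beyond the grid [phi] is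
    constant, because both potentials decay there at the same exponential rate. *)
Lemma log_ratio_cell k x : (k <= N)%N -> C k x -> `|phi (x / b) - phi (y k)| <= 2 * h.
Proof.
move=> kN Ckx.
have lip t : `|t - y k| <= h -> `|phi t - phi (y k)| <= 2 * h.
  by move=> th; apply: (le_trans (log_ratio_lip b_gt0 g0a g1a _ _)); lra.
have Sk : y k.+1 = y k + h by rewrite -natr1; ring.
have low : (0 < k)%N -> y k <= x / b.
  by move=> k0; rewrite ler_pdivlMr// mulrC; exact: cell_lower Ckx k0.
have upp : (k < N)%N -> x / b < y k + h.
  by move=> k1; rewrite -Sk ltr_pdivrMr// mulrC; exact: cell_upper Ckx k1.
have h20 : 0 <= 2 * h by rewrite mulr_ge0// ltW.
have [xk|kx] := leP (x / b) (y k).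
  have [k0|k0] := posnP k.
    have E : y k = - A by rewrite k0 mul0r addr0.
    have -> : x / b = y k - (y k - x / b) by ring.
    rewrite log_ratio_left ?subrr ?normr0//; last by rewrite subr_ge0.
    by rewrite E lerN2.
  by apply: lip; have := low k0; have := h_gt0; rewrite ler_norml; lra.
have [kN'|kN'] := ltnP k N.
  by apply: lip; have := upp kN'; rewrite ler_norml; lra.
have kE : k = N by apply/eqP; rewrite eqn_leq kN kN'.
have E : y k = A by rewrite kE NA; ring.
have -> : x / b = y k + (x / b - y k) by ring.
rewrite log_ratio_right ?subrr ?normr0//; last by rewrite subr_ge0 ltW.
by rewrite E.
Qed.

(** The density is bounded below on the grid interval, up to a factor that
    depends on [A] only; the half-lines contain a full cell each. *)
Lemma cell_mass_ge k : (k <= N)%N -> h * (expR (- (2 * A + 1)) / 2) <= p k.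
Proof.
move=> kN.
pose I : set (measurableTypeR R) := `[b * y k, b * y k.+1[%classic.
have Sk : y k.+1 = y k + h by rewrite -natr1; ring.
have mI : measurable I by exact: measurable_itv.
have lI : mu I = (b * h)%:E.
  rewrite /I lebesgue_measure_itv/= lte_fin ltr_pM2l// Sk ltrDl h_gt0 -EFinB.
  by congr EFin; ring.
have int D : measurable D -> mu.-integrable D (EFin \o laplace_mixture a b g0).
  by move=> mD; exact: integrable_laplace_mixture.
have yk : - A <= y k <= A.
  rewrite lerDl mulr_ge0 ?(ltW h_gt0)//=.
  have : k%:R * h <= N%:R * h by rewrite ler_wpM2r ?(ltW h_gt0)// ler_nat.
  by rewrite NA => ?; lra.
apply: (@le_trans _ _ (\int[mu]_(x in I) laplace_mixture a b g0 x)); last first.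
  rewrite /Rintegral fine_le//.
  - by apply: integrable_fin_num => //; exact: int.
  - by apply: integrable_fin_num => //; [exact: measurable_cell|apply: int; exact: measurable_cell].
  - apply: ge0_subset_integral => //; first exact: measurable_cell.
    + apply/measurable_EFinP; apply: measurable_funTS; exact: measurable_laplace_mixture.
    + by move=> x _; rewrite lee_fin laplace_mixture_ge0.
    + by move=> x /=; rewrite ?in_itv/= => xI; apply: cell_itv => //; exact: ltW.
have -> : h * (expR (- (2 * A + 1)) / 2) =
    \int[mu]_(x in I) ((2 * b)^-1 * expR (- (2 * A + 1))).
  rewrite Rintegral_cst// [X in fine X](_ : _ = (b * h)%:E)//=.
  by field; rewrite gt_eqF.
apply: le_Rintegral => //; [|exact: int|].
  apply: measurable_bounded_integrable => //; last first.
    exists `|(2 * b)^-1 * expR (- (2 * A + 1))|; split; first exact: num_real.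
    by move=> M MM t _ /=; exact: ltW.
  by rewrite [X in (X < _)%E](_ : _ = (b * h)%:E) ?ltry.
move=> x /=; rewrite ?in_itv/= => /andP[x1 x2].
rewrite laplace_mixture_potential// ler_wpM2l//.
  by rewrite invr_ge0 mulr_ge0// ltW.
apply: le_trans (laplace_potential_ge b_gt0 _ g0a).
rewrite ler_expR.
have x1' : y k <= x / b by rewrite ler_pdivlMr// mulrC.
have x2' : x / b < y k + h by rewrite -Sk ltr_pdivrMr// mulrC.
have /andP[yk1 yk2] := yk.
have h4' := h4.
have xA : `|x / b| <= A + 1 by rewrite ler_norml; apply/andP; split; lra.
by have aA' := aA; lra.
Qed.

(** Discretised Kullback-Leibler bound: on each cell the ratio of the two
    masses is [exp (- phi)] up to a factor [exp (2 * h)], and the masses of the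
    second mixture add up to one. *)
Lemma discrete_kullback_leibler :
  expR (- (2 * A + 1)) / (8 * A) * (h * \sum_(k < N.+1) phi (y k) ^+ 2) <=
  \sum_(k < N.+1) p k * phi (y k) + 4 * h.
Proof.
have m1' : (\int[mu]_x (laplace_mixture a b g1 x)%:E = 1)%E.
  by rewrite (mixture_mass b_gt0 g1a) -(mixture_mass b_gt0 g0a).
have int0 D : measurable D -> mu.-integrable D (EFin \o laplace_mixture a b g0).
  by move=> mD; exact: integrable_laplace_mixture.
have int1 D : measurable D -> mu.-integrable D (EFin \o laplace_mixture a b g1).
  by move=> mD; exact: integrable_laplace_mixture.
have intZ r (f : R -> R) D : measurable D -> mu.-integrable D (EFin \o f) ->
    mu.-integrable D (EFin \o (fun x => r * f x)).
  move=> mD fi; rewrite (_ : EFin \o _ = (fun x => r%:E * (EFin \o f) x)%E).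
    exact: integrableZl.
  by apply/funext => x /=; rewrite EFinM.
pose q k := \int[mu]_(x in C k) laplace_mixture a b g1 x.
have sp : \sum_(k < N.+1) p k = 1.
  by rewrite cell_mass_sum ?(ltW b_gt0) ?(ltW h_gt0)// /Rintegral m1.
have sq : \sum_(k < N.+1) q k = 1.
  by rewrite /q cell_mass_sum ?(ltW b_gt0) ?(ltW h_gt0)// /Rintegral m1'.
have A0 : 0 < A by have := A1; lra.
have phiA k : `|phi (y k)| <= 2 * A.
  by apply: (le_trans (log_ratio_bound b_gt0 g0a g1a _)); rewrite ler_wpM2l.
have pq k : (k <= N)%N -> p k * expR (- phi (y k)) <= expR (2 * h) * q k.
  move=> kN; rewrite mulrC -RintegralZl; [|exact: measurable_cell|apply: int0; exact: measurable_cell].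
  rewrite -RintegralZl; [|exact: measurable_cell|apply: int1; exact: measurable_cell].
  apply: le_Rintegral; [exact: measurable_cell|..].
  - by apply: intZ; [|apply: int0]; exact: measurable_cell.
  - by apply: intZ; [|apply: int1]; exact: measurable_cell.
  move=> x Ckx; rewrite !laplace_mixture_exp// mulrCA [leRHS]mulrCA ler_wpM2l//.
    by rewrite invr_ge0 mulr_ge0// ltW.
  rewrite -!expRD ler_expR.
  have := log_ratio_cell kN Ckx; rewrite ler_norml => /andP[_].
  rewrite {1}/log_ratio; move: (log_potential a b g0 _) (log_potential a b g1 _) (phi _).
  by move=> u v w; lra.
have quad k : (k <= N)%N ->
    p k * (1 - phi (y k)) + expR (- (2 * A + 1)) / (8 * A) * (h * phi (y k) ^+ 2) <=
    expR (2 * h) * q k.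
  move=> kN; apply: le_trans (pq k kN).
  have pk := cell_mass_ge kN.
  have pk0 : 0 <= p k.
    by apply: le_trans pk; rewrite mulr_ge0 ?divr_ge0 ?expR_ge0// ltW.
  have := @expR_ge_quad _ (2 * A) (- phi (y k)) _ _.
  have e2 : 2 <= 2 * A by have := A1; lra.
  rewrite normrN => /(_ e2 (phiA k)); rewrite sqrrN.
  move: (phi (y k)) (p k) pk pk0 (expR (- phi (y k))) => f P pk pk0 E ex.
  apply: (@le_trans _ _ (P * (1 - f + f ^+ 2 / (2 * (2 * A))))); last by rewrite ler_wpM2l.
  rewrite [leRHS]mulrDr lerD2l.
  have -> : expR (- (2 * A + 1)) / (8 * A) * (h * f ^+ 2) =
    (h * (expR (- (2 * A + 1)) / 2)) * (f ^+ 2 / (2 * (2 * A))).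
    by field; rewrite gt_eqF.
  by rewrite ler_wpM2r// divr_ge0 ?sqr_ge0//; lra.
have e2h : expR (2 * h) <= 1 + 4 * h.
  by have := @expR_le_lin _ (2 * h); have := h_gt0; have := h4; move=> ? ?; move=> /(_ _ _) H;
    apply: (le_trans (H _ _)); lra.
have : \sum_(k < N.+1) (p k * (1 - phi (y k)) +
    expR (- (2 * A + 1)) / (8 * A) * (h * phi (y k) ^+ 2)) <= expR (2 * h).
  apply: (@le_trans _ _ (\sum_(k < N.+1) expR (2 * h) * q k)).
    by apply: ler_sum => k _; apply: quad; rewrite -ltnS.
  by rewrite -mulr_sumr sq mulr1.
rewrite big_split/=.
have -> : \sum_(k < N.+1) p k * (1 - phi (y k)) =
    \sum_(k < N.+1) p k - \sum_(k < N.+1) p k * phi (y k).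
  by rewrite -sumrB; apply: eq_bigr => k _; rewrite mulrBr mulr1.
rewrite sp.
have -> : \sum_(k < N.+1) expR (- (2 * A + 1)) / (8 * A) * (h * phi (y k) ^+ 2) =
    expR (- (2 * A + 1)) / (8 * A) * (h * \sum_(k < N.+1) phi (y k) ^+ 2).
  by rewrite !mulr_sumr.
move: (\sum_(k < N.+1) p k * _) (_ / _ * _) => s1 s2; lra.
Qed.

(** Only the comparison of the two likelihoods enters: the empirical mean of
    [phi] is nonpositive, and cell by cell [phi] is nearly constant. *)
Lemma likelihood_cells n (x : 'I_n -> R) :
  \sum_(i < n) ln (laplace_mixture a b g0 (x i)) <=
  \sum_(i < n) ln (laplace_mixture a b g1 (x i)) ->
  \sum_(k < N.+1) phi (y k) * (\sum_(i < n) \1_(C k) (x i)) <= n%:R * (2 * h).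
Proof.
move=> lik.
have lnE g z : prob_on a g -> ln (laplace_mixture a b g z) =
    ln (2 * b)^-1 + log_potential a b g (z / b).
  move=> ga; rewrite laplace_mixture_exp// lnM ?posrE ?expR_gt0//.
    by rewrite expRK.
  by rewrite invr_gt0 mulr_gt0.
have phi0 : \sum_(i < n) phi (x i / b) <= 0.
  rewrite sumrB subr_le0.
  move: lik; under eq_bigr do rewrite lnE//; under [leRHS]eq_bigr do rewrite lnE//.
  by rewrite !big_split/= lerD2l.
have -> : \sum_(k < N.+1) phi (y k) * (\sum_(i < n) (\1_(C k) (x i) : R)) =
    \sum_(i < n) \sum_(k < N.+1) phi (y k) * \1_(C k) (x i).
  by rewrite exchange_big/=; apply: eq_bigr => k _; rewrite mulr_sumr.
apply: (@le_trans _ _ (\sum_(i < n) (phi (x i / b) + 2 * h))); last first.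
  by rewrite big_split/= sumr_const card_ord -[_ *+ n]mulr_natl gerDr.
apply: ler_sum => i _.
have <- : \sum_(k < N.+1) (phi (x i / b) + 2 * h) * \1_(C k) (x i) =
    phi (x i / b) + 2 * h.
  by rewrite -mulr_sumr cell_indicator_sum ?mulr1// ltW.
apply: ler_sum => k _.
have [Ck|Ck] := pselect (C k (x i)); last by rewrite indicE memNset// !mulr0.
rewrite indicE mem_set// !mulr1.
have := @log_ratio_cell k (x i) _ Ck; rewrite -ltnS ltn_ord => /(_ isT).
by rewrite ler_norml; move: (phi _) (phi _) => u v /andP[? ?]; lra.
Qed.

End Likelihood.

(** * Deterministic rates *)

Section Rates.
Variable R : realType.
Implicit Types w D S V M kappa c : R.

(** The bound on [D * w^12] delivered by [rate_arith]. *)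
Definition norm_const kappa c M : R :=
  (1 + (Num.sqrt (2 * M * (51 + 14 * c)) + 6) / kappa) ^+ 2.

(** With [w = n^(1/16)], put [t^2 = D * w^12] and [s = S * w^4]. The hypotheses
    read [s^3 <= 7 t^2], [V^2 <= 2 M w^8 (2 t^2 + 2 c s + s^2)] and
    [kappa w^4 t^2 <= |V| + 6]: for [t > 1] the right-hand side grows linearly in
    [t] and the left-hand side quadratically. *)
Lemma rate_arith w D S V M kappa c : 1 <= w -> 0 <= D -> 0 <= S ->
  S ^+ 3 <= 7 * D -> 0 <= M -> 0 < kappa -> 0 <= c ->
  V ^+ 2 <= 2 * (M * w ^+ 16) * (2 * w ^+ 4 * D + 2 * c * S / w ^+ 4 + S ^+ 2) ->
  w ^+ 16 * (kappa * D) <= `|V| + 6 ->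
  D * w ^+ 12 <= norm_const kappa c M.
Proof.
move=> w1 D0 S0 SD M0 k0 c0 hV hD.
have w0 : 0 < w by lra.
have w4 : 1 <= w ^+ 4 by rewrite exprn_ege1.
have Dw0 : 0 <= D * w ^+ 12 by rewrite mulr_ge0// exprn_ge0// ltW.
pose t := Num.sqrt (D * w ^+ 12).
have t2 : t ^+ 2 = D * w ^+ 12 by rewrite sqr_sqrtr.
have t0 : 0 <= t by exact: sqrtr_ge0.
rewrite /norm_const -t2; set r := Num.sqrt _.
have r0 : 0 <= r by exact: sqrtr_ge0.
have rk : 0 <= (r + 6) / kappa by rewrite divr_ge0 ?(ltW k0)//; lra.
rewrite lerXn2r ?nnegrE//; first by lra.
have [t1|t1] := leP t 1; first by lra.
suff : t <= (r + 6) / kappa by lra.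
pose s := S * w ^+ 4.
have s0 : 0 <= s by rewrite mulr_ge0// exprn_ge0// ltW.
have s3 : s ^+ 3 <= 7 * t ^+ 2.
  rewrite t2 (_ : s ^+ 3 = S ^+ 3 * w ^+ 12); last by rewrite /s; ring.
  by rewrite [leRHS]mulrA; apply: ler_wpM2r => //; rewrite exprn_ge0// ltW.
have st : s <= 7 * t.
  rewrite leNgt; apply/negP => ts.
  have h1 : (7 * t) ^+ 3 <= s ^+ 3 by rewrite lerXn2r ?nnegrE//; lra.
  have h2 : t ^+ 2 <= t ^+ 3 by rewrite exprS ler_peMl ?sqr_ge0// ltW.
  have : (7 * t) ^+ 3 = 343 * t ^+ 3 by ring.
  have : 0 < t ^+ 2 by rewrite exprn_gt0//; lra.
  lra.
have V2 : V ^+ 2 <= (w ^+ 4 * t * r) ^+ 2.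
  apply: (le_trans hV).
  have -> : 2 * (M * w ^+ 16) * (2 * w ^+ 4 * D + 2 * c * S / w ^+ 4 + S ^+ 2) =
      w ^+ 8 * (2 * M) * (2 * t ^+ 2 + 2 * c * s + s ^+ 2).
    by rewrite t2 /s; field; rewrite gt_eqF.
  have -> : (w ^+ 4 * t * r) ^+ 2 = w ^+ 8 * (2 * M) * (t ^+ 2 * (51 + 14 * c)).
    rewrite exprMn /r sqr_sqrtr; first by ring.
    by rewrite mulr_ge0//; [rewrite mulr_ge0|lra].
  apply: ler_wpM2l.
    by apply: mulr_ge0; [rewrite exprn_ge0// ltW|rewrite mulr_ge0].
  have h1 : s ^+ 2 <= (7 * t) ^+ 2 by rewrite lerXn2r ?nnegrE//; lra.
  have h2 : c * s <= c * (7 * t) by rewrite ler_wpM2l.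
  have h3 : c * t <= c * t ^+ 2 by rewrite ler_wpM2l// expr2 ler_peMl// ltW.
  have : (7 * t) ^+ 2 = 49 * t ^+ 2 by ring.
  lra.
have Vt : `|V| <= w ^+ 4 * t * r.
  have p0 : 0 <= w ^+ 4 * t * r.
    by rewrite mulr_ge0// mulr_ge0// exprn_ge0// ltW.
  by rewrite -(@ler_pXn2r _ 2) ?nnegrE// real_normK ?num_real.
have : kappa * (w ^+ 4 * t ^+ 2) <= w ^+ 4 * t * r + 6.
  rewrite (_ : kappa * _ = w ^+ 16 * (kappa * D)); first by lra.
  by rewrite t2; ring.
have w4t : 1 <= w ^+ 4 * t by rewrite -[leLHS]mulr1 ler_pM// ltW.
have : 0 < w ^+ 4 * t by lra.
rewrite ler_pdivlMr// => wt0 h.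
rewrite -(ler_pM2l wt0); move: h.
rewrite (_ : kappa * (w ^+ 4 * t ^+ 2) = w ^+ 4 * t * (t * kappa)); last by ring.
lra.
Qed.

Lemma sum_shift_reindex n K (v : nat -> R) :
  \sum_(s < n) \sum_(k < K) v (s + k * n)%N = \sum_(j < K * n) v j.
Proof.
rewrite exchange_big/=; elim: K => [|K IH]; first by rewrite !big_ord0.
rewrite big_ord_recr/= IH mulSn addnC -(big_mkord xpredT v) -[in RHS](big_mkord xpredT v).
rewrite [RHS](@big_cat_nat _ _ _ (K * n))//=; last exact: leq_addr.
congr (_ + _); rewrite -{2}[(K * n)%N]add0n big_addn addnC addnK big_mkord.
by apply: eq_bigr => i _; rewrite addnC.
Qed.

Lemma exists_le_mean n (v : 'I_n -> R) (m : R) : (0 < n)%N ->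
  \sum_(i < n) v i <= n%:R * m -> exists i, v i <= m.
Proof.
move=> n0 h; apply: contrapT => /forallNP H.
have : \sum_(i < n) m < \sum_(i < n) v i.
  apply: ltr_sum; first by case: n n0 {v h H} => // n _; apply/hasP; exists ord0; rewrite ?mem_index_enum.
  by move=> i _; rewrite ltNge; exact/negP/H.
by rewrite sumr_const card_ord -[_ *+ n]mulr_natl ltNge h.
Qed.

End Rates.

Section Deterministic.
Context (R : realType) (a b : R) (a_gt0 : 0 < a) (b_gt0 : 0 < b) (A : nat).
Context (g0 g1 : borel_prob R) (g0a : prob_on a g0) (g1a : prob_on a g1).
Hypothesis aA : a / b <= A%:R - 1.
Local Notation mu := (@lebesgue_measure R).
Local Notation phi := (log_ratio a b g0 g1).

Let A1 : 1 <= A%:R :> R.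
Proof.
have : 0 < a / b by rewrite divr_gt0.
by have := aA; lra.
Qed.

Definition grid_const : R := expR (- (2 * A%:R + 1)) / (8 * A%:R).

Lemma likelihood_norm_bound n (x : 'I_n -> R) (w h M : R) N :
  (\int[mu]_x (laplace_mixture a b g0 x)%:E = 1)%E ->
  1 <= w -> w ^+ 16 = n%:R ->
  0 < h -> h <= 4^-1 -> h * n%:R <= 1 -> h * w ^+ 4 <= 1 ->
  N%:R * h = 2 * A%:R -> 0 <= M ->
  \sum_(i < n) ln (laplace_mixture a b g0 (x i)) <=
  \sum_(i < n) ln (laplace_mixture a b g1 (x i)) ->
  let p k := \int[mu]_(x in cell b A%:R h N k) laplace_mixture a b g0 x in
  ar_energy (h * w ^+ 4)
    (fun k => \sum_(i < n) \1_(cell b A%:R h N k) (x i) - n%:R * p k) N <= M * n%:R ->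
  (h * \sum_(k < N.+1) phi (- A%:R + k%:R * h) ^+ 2) * w ^+ 12 <=
    norm_const grid_const (16 * A%:R + 8) M.
Proof.
move=> m1 w1 wn h0 h4 hn hw NA M0 lik p hQ.
have aA' : a / b <= A%:R by have := aA; lra.
pose f k := phi (- A%:R + k%:R * h).
rewrite -/(f _); set D := h * _.
have D0 : 0 <= D.
  by rewrite mulr_ge0 ?(ltW h0)//; apply: sumr_ge0 => k _; exact: sqr_ge0.
pose S := (7 * D) `^ 3^-1.
have S0 : 0 <= S by exact: powR_ge0.
have S3 : S ^+ 3 = 7 * D.
  rewrite -powR_mulrn// -powRrM mulVf// powRr1// mulr_ge0//.
have w0 : 0 < w by lra.
have fS k : (k <= N)%N -> `|f k| <= S.
  move=> kN; rewrite -(@ler_pXn2r _ 3) ?nnegrE// S3.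
  apply: (@lipschitz_sup_cube _ N f h (2 * A%:R)) => //.
  - move=> i iN; apply: (le_trans (log_ratio_lip b_gt0 g0a g1a _ _)).
    rewrite (_ : - A%:R + i.+1%:R * h - (- A%:R + i%:R * h) = h); last first.
      by rewrite -[i.+1%:R]natr1; ring.
    by rewrite ger0_norm// ltW.
  - move=> i iN; apply: (le_trans (log_ratio_bound b_gt0 g0a g1a _)).
    by rewrite ler_wpM2l.
  - by rewrite -NA ler_wpM2r ?(ltW h0)// ler_nat.
(* the smoothing scale h / tau of the filter is w^-4 = n^(-1/4) *)
set nu := fun k => _ in hQ.
pose V := \sum_(k < N.+1) f k * nu k.
have t0 : 0 < h * w ^+ 4 by rewrite mulr_gt0// exprn_gt0.
apply: (@rate_arith _ w D S V M) => //.
- by rewrite S3.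
- by rewrite divr_gt0 ?expR_gt0//; have := A1; lra.
- have := ar_energy_duality nu t0 hw (fS N (leqnn N)).
  move=> /le_trans; apply; rewrite wn.
  have -> : 2 * (h * w ^+ 4) * \sum_(k < N.+1) f k ^+ 2 = 2 * w ^+ 4 * D by rewrite /D; ring.
  have Q0 : 0 <= ar_energy (h * w ^+ 4) nu N.
    rewrite addr_ge0 ?sqr_ge0// mulr_ge0 ?(ltW t0)//.
    by apply: sumr_ge0 => k _; exact: sqr_ge0.
  have inc : 2 / (h * w ^+ 4) * \sum_(k < N) (f k.+1 - f k) ^+ 2 <=
      2 * (16 * A%:R + 8) * S / w ^+ 4.
    have -> : 2 * (16 * A%:R + 8) * S / w ^+ 4 =
        2 / (h * w ^+ 4) * (S * (h * (8 * (N%:R * h) + 8))).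
      by rewrite NA; field; rewrite !gt_eqF.
    rewrite ler_wpM2l ?divr_ge0 ?(ltW t0)//.
    case: (N) fS => [|N'] fS'.
      rewrite big_ord0; apply: mulr_ge0 => //; apply: mulr_ge0; first exact: ltW.
      by rewrite mul0r mulr0 add0r.
    exact: log_ratio_increments.
  apply: ler_pM.
  + by rewrite mulr_ge0.
  + apply: addr_ge0; last exact: sqr_ge0.
    apply: addr_ge0; first by rewrite mulr_ge0// mulr_ge0// exprn_ge0// ltW.
    by rewrite mulr_ge0 ?divr_ge0 ?(ltW t0)//; apply: sumr_ge0 => k _; exact: sqr_ge0.
  + by rewrite ler_wpM2l.
  + by rewrite lerD2r lerD2l.
rewrite wn.
have kl := @discrete_kullback_leibler R a b A%:R h N b_gt0 h0 h4 A1 aA' NA g0 g1 g0a g1a m1.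
have lk := @likelihood_cells R a b A%:R h N b_gt0 h0 aA' NA g0 g1 g0a g1a n x lik.
have VE : V = \sum_(k < N.+1) f k * (\sum_(i < n) \1_(cell b A%:R h N k) (x i)) -
    n%:R * \sum_(k < N.+1) p k * f k.
  rewrite mulr_sumr -sumrB; apply: eq_bigr => k _; rewrite /nu; ring.
have nh : n%:R * (grid_const * D) <= n%:R * (\sum_(k < N.+1) p k * f k + 4 * h).
  by rewrite ler_wpM2l.
have := ler_norm (- V); rewrite normrN VE.
move: lk; rewrite -/(f _); move: (\sum_(k < N.+1) f k * _) nh => s1.
move: (\sum_(k < N.+1) p k * f k) => s2; lra.
Qed.

(** The [n] shifts of a grid of mesh [1 / p] exhaust the grid of mesh
    [1 / (p * n)], so one of them sees at most the average of [|phi|]. *)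
Lemma wasserstein_of_norm n p (h : R) N : (0 < n)%N -> (4 <= p)%N ->
  h = (p * n)%:R^-1 -> N = (2 * A * p * n)%N ->
  (wasserstein1 g1 g0 <= (b * ((3 + 2 * A%:R) / p%:R + (8 * A%:R + 2) *
    (p%:R * Num.sqrt (2 * A%:R *
      (h * \sum_(k < N.+1) phi (- A%:R + k%:R * h) ^+ 2)))))%:E)%E.
Proof.
move=> n0 p4 hE NN.
have aA' := aA.
pose e : R := p%:R^-1.
have p0 : 0 < p%:R :> R by rewrite ltr0n (leq_trans _ p4).
have n0' : 0 < n%:R :> R by rewrite ltr0n.
have e0 : 0 < e by rewrite invr_gt0.
have e4 : e <= 4^-1 by rewrite lef_pV2 ?posrE// ler_nat.
have h0 : 0 < h by rewrite hE invr_gt0 natrM mulr_gt0.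
have nh : n%:R * h = e by rewrite hE /e natrM; field; rewrite !gt_eqF.
have A0 : (0 < A)%N by rewrite -(ltr0n R); have := A1; lra.
pose f k := phi (- A%:R + k%:R * h).
have [J JE] : exists J, J.+2 = (2 * A * p)%N.
  have : (2 <= 2 * A * p)%N by rewrite -mulnA leq_pmulr// muln_gt0 A0 (leq_trans _ p4).
  by case: (2 * A * p)%N => [|[|J]] // _; exists J.
have Je : J%:R * e = 2 * A%:R - 2 * e.
  have : J.+2%:R * e = 2 * A%:R by rewrite JE /e !natrM; field; rewrite gt_eqF.
  by rewrite -addn2 natrD; lra.
have NE : (J.+2 * n)%N = N by rewrite JE NN.
pose D := h * \sum_(k < N.+1) f k ^+ 2.
pose L := \sum_(j < N) `|f j|.
have LD : h * L <= Num.sqrt (2 * A%:R * D).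
  have NA : N%:R * h = 2 * A%:R.
    by rewrite NN hE !natrM; field; rewrite !gt_eqF.
  have L0 : 0 <= L by apply: sumr_ge0.
  have hL : (h * L) ^+ 2 <= 2 * A%:R * D.
    rewrite exprMn -NA /D (_ : N%:R * h * _ = h ^+ 2 * (N%:R * \sum_(k < N.+1) f k ^+ 2)); last by ring.
    rewrite ler_wpM2l ?sqr_ge0// (le_trans (sum_sqr_le N f))// ler_wpM2l//.
    by rewrite big_ord_recr/= lerDl sqr_ge0.
  rewrite -[leLHS]ger0_norm; last by rewrite mulr_ge0// ltW.
  by rewrite -sqrtr_sqr ler_wsqrtr.
pose U (s : 'I_n) := \sum_(k < J.+2) `|f (s + k * n)%N|.
have [s Us] : exists s, U s <= L / n%:R.
  apply: exists_le_mean => //; rewrite mulrC divfK ?gt_eqF//.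
  by rewrite /U (@sum_shift_reindex _ n J.+2 (fun j => `|f j|)) NE.
have sh : s%:R * h <= e.
  by rewrite -nh ler_wpM2r ?(ltW h0)// ler_nat ltnW.
have sh0 : 0 <= s%:R * h by rewrite mulr_ge0// ltW.
have x0a : - A%:R + s%:R * h + e <= - (a / b) by lra.
have ax : a / b <= - A%:R + s%:R * h + e + J%:R * e by rewrite Je; lra.
apply: (le_trans (wasserstein_potential a_gt0 b_gt0 g1a g0a e0 e4 x0a ax)).
rewrite lee_fin ler_wpM2l ?(ltW b_gt0)//.
set W := \sum_(k < J.+2) _.
have WU : W <= U s.
  apply: ler_sum => k _; apply: (le_trans (laplace_potential_dist b_gt0 g0a g1a _)).
  rewrite /f natrD natrM mulrDl -mulrA nh addrA; exact: lexx.
have Je2 : J%:R * e <= 2 * A%:R by rewrite Je; lra.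
have Je0 : 0 <= J%:R * e by rewrite mulr_ge0// ltW.
apply: lerD.
  by rewrite ler_wpM2r ?(ltW e0)//; lra.
apply: ler_pM; [lra|by apply: sumr_ge0|lra|].
apply: (le_trans WU); apply: (le_trans Us).
have -> : L / n%:R = p%:R * (h * L).
  by rewrite hE natrM; field; rewrite !gt_eqF.
by rewrite ler_wpM2l.
Qed.

End Deterministic.

(** * The maximum likelihood estimator *)

Section Sampling.
Context (R : realType) (d : measure_display) (T : measurableType d)
  (P : probability T R) (n : nat) (X : 'I_n -> {RV P >-> R}).

(** Take the whole line for all the other indices. *)
Lemma pairwise_product (i j : 'I_n) (A B : set R) : mutually_independent X ->
  measurable A -> measurable B -> i != j ->
  P ((X i @^-1` A) `&` (X j @^-1` B)) = (P (X i @^-1` A) * P (X j @^-1` B))%E.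
Proof.
move=> indep mA mB ij.
pose S m : set R := if m == i then A else if m == j then B else setT.
have mS m : measurable (S m).
  by rewrite /S; case: ifP => // _; case: ifP => // _; exact: measurableT.
have := indep S mS.
have -> : \bigcap_m (X m @^-1` S m) = (X i @^-1` A) `&` (X j @^-1` B).
  apply/seteqP; split => x.
    move=> H; split; [have := H i I|have := H j I]; rewrite /S/= eqxx//.
    by rewrite eq_sym (negbTE ij).
  move=> [xA xB] m _; rewrite /S/=; case: eqP => [->//|_]; case: eqP => [->//|_].
  by [].
rewrite (bigD1 i)//= (bigD1 j)/=; last by rewrite eq_sym.
rewrite big1 ?mule1 => [->|m /andP[mi mj]].
  by rewrite /S eqxx eq_sym (negbTE ij) eqxx.
by rewrite /S (negbTE mi) (negbTE mj) preimage_setT probability_setT.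
Qed.

End Sampling.

Lemma wasserstein1_ge0 (R : realType) (mu nu : borel_prob R) : (0 <= wasserstein1 mu nu)%E.
Proof.
apply: le_ereal_inf_tmp => _ [p _ <-]; apply: integral_ge0 => z _.
by rewrite lee_fin.
Qed.

Section Rate.
Context (R : realType) (a : R) (a_gt0 : 0 < a) (g0 : borel_prob R) (g0a : prob_on a g0).

(** Off an event of small probability the empirical energy is of order [n], and
    then every maximiser of the likelihood is close to [g0]. *)
Lemma npmle_rate (A : nat) (e : R) : 0 < e ->
  exists C : R, 0 < C /\ forall (n : nat) (w b : R) (d : measure_display)
    (T : measurableType d) (P : probability T R) (X : 'I_n -> {RV P >-> R}),
  4 <= w -> w ^+ 16 = n%:R -> 0 < b -> a / b <= A%:R - 1 ->
  mutually_independent X ->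
  (forall i, has_density (X i) (laplace_mixture a b g0)) ->
  exists B : set T, [/\ measurable B, (P B <= e%:E)%E &
    forall x, ~ B x -> forall g, is_npmle a b (fun i => X i x) g ->
      (wasserstein1 g g0 <= (b * (C / w ^+ 3))%:E)%E].
Proof.
move=> e0.
pose K := norm_const (grid_const R A) (16 * A%:R + 8) e^-1.
pose C := 3 + 2 * A%:R + (8 * A%:R + 2) * (2 * Num.sqrt (2 * A%:R * K)).
exists C; split.
  by apply: ltr_pwDl; rewrite ?ltr_pwDl// ?mulr_ge0 ?addr_ge0 ?sqrtr_ge0.
move=> n w b d T P X w4 wn b0 aA indep dens.
have w0 : 0 < w by lra.
have w3 : 64 <= w ^+ 3.
  have -> : 64 = 4 ^+ 3 :> R by ring.
  by rewrite lerXn2r ?nnegrE//; lra.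
have n0' : 0 < n%:R :> R by rewrite -wn exprn_gt0.
have n0 : (0 < n)%N by rewrite -(ltr0n R).
(* The mesh 1 / p of the deconvolution grid is of order n^(-3/16); dividing it
   again by n makes every discretisation error negligible. *)
pose p := (Num.truncn (w ^+ 3)).+1.
have wp : w ^+ 3 < p%:R by exact: truncnS_gt.
have pw : p%:R <= 2 * w ^+ 3.
  rewrite /p -natr1; have : (Num.truncn (w ^+ 3))%:R <= w ^+ 3.
    by rewrite truncn_le ?exprn_ge0// ltW.
  by lra.
have p4 : (4 <= p)%N by rewrite -(ler_nat R); lra.
have p0 : 0 < p%:R :> R by lra.
pose h : R := (p * n)%:R^-1.
pose N := (2 * A * p * n)%N.
have h0 : 0 < h by rewrite invr_gt0 natrM mulr_gt0.
have hn : h * n%:R = p%:R^-1 by rewrite /h natrM; field; rewrite !gt_eqF.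
have pV : p%:R^-1 <= 1 :> R by rewrite invf_le1//; lra.
have n1 : 1 <= n%:R :> R by rewrite ler1n.
have h4 : h <= 4^-1.
  rewrite lef_pV2 ?posrE ?natrM ?mulr_gt0//.
  have : p%:R * 1 <= p%:R * n%:R :> R by rewrite ler_wpM2l// ltW.
  by lra.
have hw : h * w ^+ 4 <= 1.
  apply: le_trans pV; rewrite -hn ler_wpM2l ?(ltW h0)// -wn.
  by rewrite ler_weXn2l//; lra.
have NA : N%:R * h = 2 * A%:R.
  by rewrite /N /h !natrM; field; rewrite !gt_eqF.
have m1 : (\int[lebesgue_measure]_x (laplace_mixture a b g0 x)%:E = 1)%E.
  have := dens (Ordinal n0) setT measurableT.
  by move=> <-; rewrite /distribution /pushforward preimage_setT probability_setT.
pose cl k : set (measurableTypeR R) := cell b A%:R h N k.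
pose q k : R := \int[lebesgue_measure]_(x in cl k) laplace_mixture a b g0 x.
pose AX i k : set T := X i @^-1` cl k.
have mAX i k : measurable (AX i k).
  by apply: measurable_funPTI => //; exact: measurable_cell.
have PAX i k : P (AX i k) = (q k)%:E.
  have E := dens i (cl k) (measurable_cell _ _ _ _ _).
  rewrite -[LHS]/(distribution P (X i) (cl k)) E /q /Rintegral fineK// -E.
  by apply: fin_num_measure; exact: measurable_cell.
have q0 k : 0 <= q k by apply: Rintegral_ge0 => x _; exact: laplace_mixture_ge0.
have int D : measurable D -> (@lebesgue_measure R).-integrable D
    (EFin \o laplace_mixture a b g0).
  by move=> mD; exact: integrable_laplace_mixture.
have q1 : \sum_(k < N.+1) q k <= 1.
  by rewrite /q cell_mass_sum ?(ltW b0) ?(ltW h0)// /Rintegral m1.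
have t0 : 0 < h * w ^+ 4 by rewrite mulr_gt0// exprn_gt0.
have disj i k l : k != l -> AX i k `&` AX i l = set0.
  by move=> kl; rewrite -preimage_setI cell_disjoint ?preimage_set0// ltW.
have prod i j k l : i != j -> fine (P (AX i k `&` AX j l)) = q k * q l.
  move=> ij; rewrite pairwise_product//; try exact: measurable_cell.
  by rewrite [P (X i @^-1` _)]PAX [P (X j @^-1` _)]PAX.
have [bQ eQ] := @ar_energy_mean _ T R P n N AX q (h * w ^+ 4) t0 hw q0 mAX
  (fun i k => congr1 fine (PAX i k)) disj prod q1.
set Q := (fun x => ar_energy _ _ _) in bQ eQ.
exists [set x | e^-1 * n%:R < Q x]; split.
- rewrite -[X in measurable X]setTI.
  have -> : [set x | e^-1 * n%:R < Q x] = Q @^-1` `]e^-1 * n%:R, +oo[%classic.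
    by apply/seteqP; split => x /=; rewrite in_itv/= andbT.
  by apply: bQ.1 => //; exact: measurable_itv.
- have Q0 x : 0 <= Q x.
    rewrite addr_ge0 ?sqr_ge0// mulr_ge0 ?(ltW t0)//.
    by apply: sumr_ge0 => k _; exact: sqr_ge0.
  have en : 0 < e^-1 * n%:R by rewrite mulr_gt0 ?invr_gt0.
  have := bounded_markov bQ Q0 eQ en.
  by rewrite (_ : n%:R / (e^-1 * n%:R) = e)//; field; rewrite !gt_eqF.
move=> x /negP; rewrite -leNgt => Qx g [ga gmax].
have lik := gmax g0 g0a.
have := @likelihood_norm_bound R a b a_gt0 b0 A g0 g g0a ga aA n (fun i => X i x) w h e^-1 N
  m1 _ wn h0 h4 _ hw NA _ lik.
rewrite hn pV => /(_ _ isT) /(_ _ _).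
have w1 : 1 <= w by lra.
have e1 : 0 <= e^-1 by rewrite invr_ge0 ltW.
move=> /(_ w1 e1).
have QE : Q x = ar_energy (h * w ^+ 4)
    (fun k => \sum_(i < n) \1_(cell b A%:R h N k) (X i x) - n%:R * q k) N.
  rewrite /Q; congr (ar_energy _ _ _); apply/funext => k; congr (_ - _).
rewrite -QE => /(_ Qx).
set D := h * _ => DK.
apply: (le_trans (wasserstein_of_norm a_gt0 b0 g0a ga aA n0 p4 erefl erefl)).
rewrite lee_fin ler_wpM2l ?(ltW b0)//.
have w30 : 0 < w ^+ 3 by lra.
rewrite -/h -/N -/D /C [leRHS]mulrDl.
have D0 : 0 <= D.
  by rewrite mulr_ge0 ?(ltW h0)//; apply: sumr_ge0 => k _; exact: sqr_ge0.
have sD : Num.sqrt (2 * A%:R * D) <= Num.sqrt (2 * A%:R * K) / w ^+ 6.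
  have w60 : 0 <= (w ^+ 6)^-1 by rewrite invr_ge0 exprn_ge0// ltW.
  rewrite -[X in _ <= _ * X](ger0_norm w60) -sqrtr_sqr -sqrtrM; last first.
    by rewrite mulr_ge0// /K sqr_ge0.
  rewrite ler_wsqrtr//.
  rewrite (_ : 2 * A%:R * K * (w ^+ 6)^-1 ^+ 2 = 2 * A%:R * (K / w ^+ 12)); last first.
    by field; rewrite gt_eqF.
  rewrite ler_wpM2l//.
  by rewrite ler_pdivlMr// exprn_gt0.
apply: lerD.
  by rewrite ler_wpM2l ?addr_ge0// lef_pV2 ?posrE// ltW.
rewrite -[leRHS]mulrA ler_wpM2l ?addr_ge0//.
apply: (@le_trans _ _ (2 * w ^+ 3 * (Num.sqrt (2 * A%:R * K) / w ^+ 6))).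
  by apply: ler_pM => //; rewrite sqrtr_ge0.
rewrite le_eqVlt; apply/orP; left; apply/eqP; field.
by rewrite gt_eqF.
Qed.

End Rate.

(** * Asymptotics *)

Section Asymptotics.
Variable R : realType.

Lemma near_ln_ge1 : \forall n \near \oo, 1 <= ln (n%:R : R).
Proof.
near=> n; have en : expR 1 <= n%:R :> R by near: n; exact: nbhs_infty_ger.
rewrite -[leLHS](expRK 1) ler_ln ?posrE ?expR_gt0//.
exact: lt_le_trans (expR_gt0 _) en.
Unshelve. all: by end_near. Qed.

Lemma sixteenth_root (n : nat) : (0 < n)%N ->
  let w : R := n%:R `^ 16^-1 in w ^+ 16 = n%:R /\ (w ^+ 3)^-1 = n%:R `^ (- (3 / 16)).
Proof.
move=> n0 w; rewrite -!powR_mulrn ?powR_ge0// -!powRrM; split.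
  by rewrite mulVf// powRr1.
by rewrite -powRN; congr (_ `^ _); lra.
Qed.

(** Both sides bound the same quotient [b n / g n]. *)
Lemma littleo_reciprocal (a : R) (b g k : nat -> R) : 0 < a ->
  (\forall n \near \oo, 0 < b n) -> (\forall n \near \oo, 0 < g n) ->
  (\forall n \near \oo, k n = (g n)^-1) ->
  b =o_\oo g <-> k =o_\oo (fun n => a / b n).
Proof.
move=> a0 b0 g0 kg; split => /eqoP H; apply/eqoP => e e0.
- near=> n.
  have bn : 0 < b n by near: n.
  have gn : 0 < g n by near: n.
  have -> : k n = (g n)^-1 by near: n.
  have : `|b n| <= e * a * `|g n| by near: n; apply: H; rewrite mulr_gt0.
  rewrite !gtr0_norm ?divr_gt0 ?invr_gt0// => h.
  by rewrite mulrA ler_pdivlMr// mulrC ler_pdivrMr.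
- near=> n.
  have bn : 0 < b n by near: n.
  have gn : 0 < g n by near: n.
  have kn : k n = (g n)^-1 by near: n.
  have : `|k n| <= e / a * `|a / b n| by near: n; apply: H; rewrite divr_gt0.
  rewrite kn !gtr0_norm ?divr_gt0 ?invr_gt0//.
  rewrite (_ : e / a * (a / b n) = e / b n); last by field; rewrite !gt_eqF.
  by rewrite ler_pdivlMr// mulrC ler_pdivrMr.
Unshelve. all: by end_near. Qed.

Lemma cvg0_outer (f : nat -> \bar R) : (forall n, 0 <= f n)%E ->
  (forall e : R, 0 < e -> \forall n \near \oo, (f n <= e%:E)%E) ->
  f n @[n --> \oo] --> 0%E.
Proof.
move=> f0 H; apply/fine_cvgP; split.
  near=> n; rewrite ge0_fin_numE//.
  have h : (f n <= 1%:E)%E by near: n; exact: H.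
  by rewrite (le_lt_trans h)// ltry.
apply/cvgrPdist_le => e e0; near=> n.
have h : (f n <= e%:E)%E by near: n; exact: H.
rewrite /= sub0r normrN ger0_norm ?fine_ge0//.
by rewrite -lee_fin fineK// ge0_fin_numE// (le_lt_trans h)// ltry.
Unshelve. all: by end_near. Qed.

Lemma outer_le d (T : measurableType d) (P : probability T R) (S B : set T) (e : R) :
  measurable B -> (P B <= e%:E)%E -> (forall x, ~ B x -> ~ S x) ->
  (mu_ext P S <= e%:E)%E.
Proof.
move=> mB Be SB; apply: le_trans Be; rewrite -(measurable_mu_extE P mB).
by apply: le_mu_ext => x Sx; apply: contrapT => /SB.
Qed.

End Asymptotics.

Theorem corollary5p3 (R : realType) (a : R) (a_gt0 : 0 < a)
  (g0 : borel_prob R) (g0_on : prob_on a g0)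
  (b : nat -> R)
  (b_gt0 : forall n, (1 <= n)%N -> 0 < b n)
  (b_nondecreasing : forall m n, (1 <= m)%N -> (m <= n)%N -> b m <= b n)
  (d : nat -> measure_display) (T : forall n, measurableType (d n))
  (P : forall n, probability (T n) R)
  (X : forall n, 'I_n -> {RV (P n) >-> R})
  (X_indep : forall n, mutually_independent (X n))
  (X_density : forall n (i : 'I_n),
     has_density (X n i) (laplace_mixture a (b n) g0))
  (ghat : forall n, T n -> borel_prob R)
  (ghat_npmle : forall n, (1 <= n)%N -> forall w : T n,
     is_npmle a (b n) (fun i : 'I_n => X n i w) (ghat n w)) :
  let W := fun n (w : T n) => wasserstein1 (ghat n w) g0 in
  let eps := fun n => 2 * a / b n in
  [/\ bigOp P W (fun n => a * n%:R `^ (- (3 / 8)) +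
        b n * n%:R `^ (- (3 / 16)) * Num.sqrt (ln n%:R)),
      b =o_\oo (fun n => n%:R `^ (3 / 16) * (ln n%:R) `^ (- 2^-1)) ->
        cvg0_in_prob P W &
      b =o_\oo (fun n => n%:R `^ (3 / 16) * (ln n%:R) `^ (- 2^-1)) <->
        (fun n => n%:R `^ (- (3 / 16)) * (ln n%:R) `^ 2^-1) =o_\oo eps].
Proof.
move=> W eps.
have near1 : \forall n \near \oo, (1 <= n)%N by exists 1%N.
have tail (e : R) : 0 < e -> exists C : R, 0 < C /\ \forall n \near \oo,
    exists B : set (T n), [/\ measurable B, (P n B <= e%:E)%E &
      forall x, ~ B x -> (W n x <= (C * (b n * n%:R `^ (- (3 / 16))))%:E)%E].
  move=> e0.
  (* this integer exceeds a / b n + 1 for all n, because b is nondecreasing *)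
  have [C [C0 HC]] := npmle_rate a_gt0 g0_on (Num.truncn (a / b 1%N)).+2 e0.
  exists C; split => //; near=> n.
  have n1 : (1 <= n)%N by near: n.
  have [wn w3] := @sixteenth_root R n n1.
  set w := n%:R `^ 16^-1 in wn w3.
  have w0 : 0 <= w by exact: powR_ge0.
  have w4 : 4 <= w.
    rewrite -(@ler_pXn2r _ 16) ?nnegrE// wn.
    by near: n; exact: nbhs_infty_ger.
  have bn := b_gt0 n n1.
  have aA : a / b n <= (Num.truncn (a / b 1%N)).+2%:R - 1.
    rewrite -[in leRHS]natr1 addrK; apply: le_trans (ltW (truncnS_gt _)).
    by rewrite ler_wpM2l ?(ltW a_gt0)// lef_pV2 ?posrE ?b_gt0// b_nondecreasing.
  have [B [mB PB HB]] := HC n w (b n) _ _ (P n) (X n) w4 wn bn aA (X_indep n) (X_density n).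
  exists B; split => // x Bx; apply: le_trans (HB x Bx _ (ghat_npmle n n1 x)) _.
  by rewrite w3 mulrCA.
have W0 n x : (0 <= W n x)%E by exact: wasserstein1_ge0.
split.
- move=> e e0; have [C [C0 HC]] := tail e e0; exists C; near=> n.
  have [B [mB PB HB]] : exists B : set (T n), [/\ measurable B, (P n B <= e%:E)%E &
      forall x, ~ B x -> (W n x <= (C * (b n * n%:R `^ (- (3 / 16))))%:E)%E].
    by near: n.
  apply: outer_le mB PB _ => x /HB Wx; apply/negP; rewrite -leNgt.
  have bn : 0 < b n by apply: b_gt0; near: n.
  have n0 : 0 < n%:R :> R by rewrite ltr0n; near: n.
  have ln1 : 1 <= ln (n%:R : R) by near: n; exact: near_ln_ge1.
  set rho := _ + _.
  have r0 : 0 < b n * n%:R `^ (- (3 / 16)) by rewrite mulr_gt0// powR_gt0.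
  have br : b n * n%:R `^ (- (3 / 16)) <= rho.
    rewrite /rho ler_wpDl// ?mulr_ge0 ?powR_ge0 ?(ltW a_gt0)//.
    by rewrite ler_peMr ?(ltW r0)// -[leLHS]sqrtr1 ler_wsqrtr.
  have rho0 : 0 < rho by exact: lt_le_trans br.
  rewrite gee0_abs; last by rewrite mule_ge0// lee_fin invr_ge0 ltW.
  rewrite lee_pdivrMr// -EFinM; apply: le_trans Wx _.
  by rewrite lee_fin ler_wpM2l// ltW.
- move=> /eqoP bo e e0; apply: cvg0_outer => [n|e1 e10]; first exact: mu_ext_ge0.
  have [C [C0 HC]] := tail e1 e10; near=> n.
  have [B [mB PB HB]] : exists B : set (T n), [/\ measurable B, (P n B <= e1%:E)%E &
      forall x, ~ B x -> (W n x <= (C * (b n * n%:R `^ (- (3 / 16))))%:E)%E].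
    by near: n.
  apply: outer_le mB PB _ => x /HB Wx; apply/negP; rewrite -leNgt gee0_abs//.
  apply: le_trans Wx _; rewrite lee_fin.
  have n0 : 0 < n%:R :> R by rewrite ltr0n; near: n.
  have ln1 : 1 <= ln (n%:R : R) by near: n; exact: near_ln_ge1.
  have h : `|b n| <= e / C * `|n%:R `^ (3 / 16) * ln n%:R `^ (- 2^-1)|.
    by near: n; apply: bo; rewrite divr_gt0.
  have l1 : ln (n%:R : R) `^ (- 2^-1) <= 1.
    rewrite powRN invf_le1 ?powR_gt0//; last by lra.
    have one : 1 `^ 2^-1 = 1 :> R by rewrite powR1.
    by rewrite -[leLHS]one ge0_ler_powR ?nnegrE//; lra.
  have pn : 0 < n%:R `^ (3 / 16) :> R by rewrite powR_gt0.
  have {}h : b n <= e / C * n%:R `^ (3 / 16).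
    apply: (le_trans (ler_norm _)); apply: (le_trans h).
    rewrite ler_wpM2l ?divr_ge0 ?(ltW e0) ?(ltW C0)//.
    by rewrite ger0_norm ?mulr_ge0 ?powR_ge0// ler_piMr// ltW.
  rewrite powRN mulrA ler_pdivrMr// mulrC.
  by rewrite -ler_pdivlMr// mulrAC.
- apply: littleo_reciprocal; first by rewrite mulr_gt0.
  + by near=> n; apply: b_gt0; near: n.
  + near=> n; have ln1 : 1 <= ln (n%:R : R) by near: n; exact: near_ln_ge1.
    have n0 : 0 < n%:R :> R by rewrite ltr0n; near: n.
    by rewrite mulr_gt0// powR_gt0//; lra.
  + near=> n; rewrite invfM !powRN invrK; congr (_ * _).
Unshelve. all: by end_near. Qed.
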